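(* Let $(Q,\mathcal{G})$ be a Riemannian manifold, $V$ a smooth function on $Q$, $L(q,\dot q)=\frac12\mathcal{G}_{ij}\dot q^i\dot q^j-V(q)$, $f^1,\dots,f^m\in\Omega^1(Q)$ with $m<n=\dim Q$, $Y^a=\sharp_{\mathcal{G}}(f^a)$, and let $\mathcal{M}=\phi^{-1}(\{0\})\subset TQ$ be a constraint submanifold such that $T\mathcal{M}$ and $\mathcal{F}^V$ are transversal along $\mathcal{M}$. Let $G$ be the Euler–Lagrange vector field of $L$, let $\hat u=(\hat u_a):\mathcal{M}\to\mathbb{R}^m$ be a control function, and let $\Gamma=G+\hat u_a (Y^a)^V$ be the corresponding closed-loop vector field of the mechanical control system $\nabla_{\dot q}\dot q=-\operatorname{grad}V+u_aY^a(q)$. Then $\Gamma$ makes $\mathcal{M}$ invariant if and only if, at every point of $\mathcal{M}$, $$i_{\Gamma}\omega_L-dE_L=-\tau^*_a (f^a)^V,\qquad \Gamma\in T\mathcal{M},$$ or, equivalently, if and only if, at every point of $\mathcal{M}$, $$i_\Gamma\omega_L-dE_L\in\flat_{\mathcal{G}^c}(\mathcal{F}^V),\qquad \Gamma\in T\mathcal{M}.$$ Here $\tau^*=(\tau^*_a):\mathcal{M}\to\mathbb{R}^m$ is the unique control function making $\mathcal{M}$ invariant, and $\flat_{\mathcal{G}^c}(\mathcal{F}^V)=\operatorname{span}\{(f^a)^V\}$.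
   Context: All objects are smooth and summation over repeated indices is understood. $Q$ has dimension $n$, with local coordinates $q^i$; $(q^i,\dot q^i)$ are the induced coordinates on $TQ$, and $\tau_Q:TQ\to Q$ is the projection. Constraint: $\phi=(\phi^1,\dots,\phi^m):TQ\to\mathbb{R}^m$ is smooth with $T_p\phi$ surjective for all $p\in\mathcal{M}=\phi^{-1}(\{0\})$, so $\mathcal{M}$ is a submanifold of $TQ$ of dimension $2n-m$. Lagrangian structure: $J=dq^i\otimes\frac{\partial}{\partial\dot q^i}$ is the canonical almost tangent structure on $TQ$ and $J^*(d\varphi)=\frac{\partial\varphi}{\partial\dot q^i}dq^i$ for $\varphi\in C^\infty(TQ)$. $E_L=\dot q^i\frac{\partial L}{\partial\dot q^i}-L$ is the energy; $\omega_L=-d(J^*(dL))$ is a symplectic form on $TQ$; $i_X\omega_L=\omega_L(X,\cdot)$. The Euler–Lagrange vector field $G$ is defined by $i_G\omega_L=dE_L$. Riemannian notation: $\flat_{\mathcal{G}}(X)=\mathcal{G}(X,\cdot)$, $\sharp_{\mathcal{G}}=\flat_{\mathcal{G}}^{-1}$, $\operatorname{grad}V=\sharp_{\mathcal{G}}(dV)$, $\nabla$ is the Levi-Civita connection. Lifts: for $X=X^i\frac{\partial}{\partial q^i}\in\mathfrak{X}(Q)$ the vertical lift is $X^V=X^i\frac{\partial}{\partial\dot q^i}$; for $\alpha=\alpha_idq^i\in\Omega^1(Q)$ the vertical lift is $\alpha^V=\tau_Q^*\alpha$. The complete lift $\mathcal{G}^c$ is the semi-Riemannian metric on $TQ$ given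 by $\mathcal{G}^c=\dot q^k\frac{\partial\mathcal{G}_{ij}}{\partial q^k}dq^i\otimes dq^j+\mathcal{G}_{ij}dq^i\otimes d\dot q^j+\mathcal{G}_{ij}d\dot q^i\otimes dq^j$, with $\flat_{\mathcal{G}^c}(X)=\mathcal{G}^c(X,\cdot)$ and $\sharp_{\mathcal{G}^c}=\flat_{\mathcal{G}^c}^{-1}$. Input distribution: $\mathcal{F}=\operatorname{span}\{Y^a\}\subseteq TQ$, and $\mathcal{F}^V$ is the distribution on $TQ$ spanned by the vector fields $(Y^a)^V=\sharp_{\mathcal{G}^c}((f^a)^V)$. Transversality: subspaces $W_1,W_2$ of a vector space $W$ are transversal if $W=W_1+W_2$ and $\dim W=\dim W_1+\dim W_2$. It is assumed that $T_{v_q}\mathcal{M}$ and $\mathcal{F}^V_{v_q}$ are transversal in $T_{v_q}(TQ)$ for every $v_q\in\mathcal{M}$. Invariance: a control function is a smooth map $\hat u:\mathcal{M}\to\mathbb{R}^m$; it (or the closed-loop vector field $\Gamma=G+\hat u_a(Y^a)^V$) makes $\mathcal{M}$ invariant if the flow $\psi_t$ of the closed-loop system in $TQ$ (defined using a smooth extension of $\hat u$ to a neighbourhood of $\mathcal{M}$) satisfies $\psi_t(\mathcal{M})\subseteq\mathcal{M}$ for all times at which it is defined. It is a known theorem that, under the transversality assumption, there exists a unique control function $\tau^*:\mathcal{M}\to\mathbb{R}^m$ making $\mathcal{M}$ invariant. *)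

(* Defs.v *)
From HB Require Import structures.
From mathcomp Require Import all_boot all_order all_algebra.
From mathcomp Require Import all_classical reals landau topology normedtype.
From mathcomp Require Import derive.

Set Implicit Arguments.
Unset Strict Implicit.
Unset Printing Implicit Defensive.

Import Order.TTheory GRing.Theory Num.Theory.
Import numFieldNormedType.Exports.

Local Open Scope classical_set_scope.
Local Open Scope ring_scope.

(* Meant for open [A]; on a finite-dimensional [V], where every continuous    *)
(* partial derivative is some 'D_v f, this is membership in C^k(A, W).        *)
Fixpoint cdiff_on (R : realType) (V W : normedModType R) (k : nat) (A : set V)
    (f : V -> W) : Prop :=
  match k with
  | 0 => forall x, A x -> {for x, continuous f}
  | k'.+1 => (forall x, A x -> differentiable f x) /\
             (forall v, cdiff_on k' A ('D_v f))
  end.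

Definition smooth_on (R : realType) (V W : normedModType R) (A : set V)
    (f : V -> W) : Prop :=
  forall k, cdiff_on k A f.

Section SmoothCalculus.
Context {R : realType}.
Implicit Types U V W : normedModType R.

Lemma diff_near_eq V W (f g : V -> W) x : (\near x, f x = g x) ->
  differentiable f x -> differentiable g x /\ 'd g x = 'd f x :> (V -> W).
Proof.
move=> fg df; have fgx : f x = g x by exact: nbhs_singleton fg.
have fg0 : \forall h \near (0 : V), f (h + x) = g (h + x).
  by move: fg; rewrite (near_shift 0) subr0.
have gE : g \o shift x = cst (g x) + 'd f x +o_ 0 id.
  apply/eqaddoP => e e0.
  have := diff_locally df => /eqaddoP /(_ e e0) H.
  apply: filterS2 H fg0 => h /= H fgh.
  by move: H; rewrite !fctE /= fgh fgx.
have gd : 'd g x = 'd f x :> (V -> W).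
  by apply: diff_unique => //; exact: diff_continuous.
split=> //; apply/diff_locallyP; split; last by rewrite gd.
by rewrite gd; exact: diff_continuous.
Qed.

Lemma diff_comp_at U V W (f : U -> V) (g : V -> W) (h : U -> W) x y a :
  f x = y -> (\near x, h x = g (f x)) -> differentiable f x ->
  differentiable g y -> 'd g y ('d f x a) = 'd h x a.
Proof.
move=> <- hE df dg.
have E : 'd (g \o f) x = 'd g (f x) \o 'd f x :> (U -> W) by exact: diff_comp.
have dgf : differentiable (g \o f) x by exact: differentiable_comp.
have hE' : \near x, (g \o f) x = h x by near do rewrite /=; near do apply/esym.
have [_ ->] := diff_near_eq hE' dgf.
by rewrite E.
Unshelve. all: by end_near. Qed.

Lemma cdiff_onS V W k (A B : set V) (f : V -> W) :
  A `<=` B -> cdiff_on k B f -> cdiff_on k A f.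
Proof.
move=> AB; elim: k f => [|k IH] f /=; first by move=> cf x /AB; exact: cf.
by move=> [df Df]; split=> [x /AB /df //|v]; apply: IH; exact: Df.
Qed.

Lemma cdiff_onW V W k (A : set V) (f : V -> W) :
  cdiff_on k.+1 A f -> cdiff_on k A f.
Proof.
elim: k f => [|k IH] f [df Df]; first by move=> x /df /differentiable_continuous.
by split=> // v; apply: IH; exact: Df.
Qed.

Lemma cdiff_on_cst V W k (A : set V) (a : W) : cdiff_on k A (cst a : V -> W).
Proof.
elim: k a => [|k IH] a /=; first by move=> x _; exact: cst_continuous.
split=> [x _|v]; first exact: differentiable_cst.
rewrite (_ : 'D_v _ = cst 0) //.
by apply/funext => x; rewrite derive_cst.
Qed.

Lemma cdiff_on_id V k (A : set V) : cdiff_on k A (id : V -> V).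
Proof.
case: k => [|k] /=; first by move=> x _; exact: cvg_id.
split=> [x _|v]; first exact: ex_diff.
rewrite (_ : 'D_v _ = cst v); first exact: cdiff_on_cst.
by apply/funext => x; rewrite derive_id.
Qed.

Lemma cdiff_on_ext V W k (A : set V) (f g : V -> W) : open A ->
  (forall x, A x -> f x = g x) -> cdiff_on k A f -> cdiff_on k A g.
Proof.
move=> oA; have nA x (P : V -> Prop) : A x -> (forall y, A y -> P y) ->
    \forall y \near x, P y.
  by move=> Ax AP; apply: filterS (open_nbhs_nbhs (conj oA Ax)) => y; exact: AP.
elim: k f g => [|k IH] f g fg /=.
  move=> cf x Ax; rewrite /prop_for /continuous_at -(fg _ Ax).
  exact: cvg_trans (near_eq_cvg (nA _ _ Ax fg)) (cf _ Ax).
move=> [df Df]; split=> [x Ax|v].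
  by have [] := diff_near_eq (nA _ _ Ax fg) (df _ Ax).
by apply: (IH ('D_v f)) => // x Ax; exact: near_eq_derive (nA _ _ Ax fg).
Qed.

Lemma cdiff_on_precomp U V W k (A : set V) (L : {linear U -> V}) (f : V -> W) :
  continuous L -> open A -> cdiff_on k A f -> cdiff_on k (L @^-1` A) (f \o L).
Proof.
move=> cL oA; elim: k f => [|k IH] f /=.
  by move=> cf x Ax; apply: continuous_comp; [exact: cL|exact: cf].
move=> [df Df]; have dL x : differentiable L x by exact: linear_differentiable.
split=> [x Ax|v]; first by apply: differentiable_comp => //; exact: df.
apply: (cdiff_on_ext (f := 'D_(L v) f \o L)); last exact: IH.
  by apply: open_comp => // x _; exact: cL.
move=> x Ax; rewrite [RHS]deriveE; last first.
  by apply: differentiable_comp => //; exact: df.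
by rewrite diff_comp //= ?diff_lin // ?deriveE //; exact: df.
Qed.

Lemma cdiff_onD V W k (A : set V) (f g : V -> W) : open A ->
  cdiff_on k A f -> cdiff_on k A g -> cdiff_on k A (fun x => f x + g x).
Proof.
move=> oA; elim: k f g => [|k IH] f g.
  by move=> cf cg x Ax; apply: cvgD; [exact: cf|exact: cg].
move=> [df Df] [dg Dg]; split=> [x Ax|v].
  by apply: differentiableD; [exact: df|exact: dg].
apply: (cdiff_on_ext (f := fun x => 'D_v f x + 'D_v g x)) => //; last first.
  by apply: IH; [exact: Df|exact: Dg].
by move=> x Ax; rewrite deriveD //; apply: diff_derivable; [exact: df|exact: dg].
Qed.

Lemma cdiff_on_sum V W k (A : set V) (I : Type) (r : seq I) (f : I -> V -> W) :
  open A -> (forall i, cdiff_on k A (f i)) ->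
  cdiff_on k A (fun x => \sum_(i <- r) f i x).
Proof.
move=> oA cf; elim: r => [|i r IH].
  apply: (cdiff_on_ext (f := cst 0)) => //; last exact: cdiff_on_cst.
  by move=> x _; rewrite big_nil.
apply: (cdiff_on_ext (f := fun x => f i x + \sum_(j <- r) f j x)) => //.
  by move=> x _; rewrite big_cons.
exact: cdiff_onD.
Qed.

Lemma cdiff_onM V k (A : set V) (f g : V -> R) : open A ->
  cdiff_on k A f -> cdiff_on k A g -> cdiff_on k A (fun x => f x * g x).
Proof.
move=> oA; elim: k f g => [|k IH] f g.
  by move=> cf cg x Ax; apply: cvgM; [exact: cf|exact: cg].
move=> sf sg; have [df Df] := sf; have [dg Dg] := sg; split=> [x Ax|v].
  by apply: differentiableM; [exact: df|exact: dg].
apply: (cdiff_on_ext (f := fun x => f x * 'D_v g x + g x * 'D_v f x)) => //.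
  move=> x Ax; have hf : derivable f x v by exact/diff_derivable/df.
  by have hg : derivable g x v; [exact/diff_derivable/dg|rewrite deriveM].
have [cf cg] := (cdiff_onW sf, cdiff_onW sg).
by apply: cdiff_onD => //; apply: IH => //; [exact: Dg|exact: Df].
Qed.

Lemma cdiff_on_coord V m n k (A : set V) (f : V -> 'M[R]_(m, n)) i j :
  open A -> cdiff_on k A f -> cdiff_on k A (fun x => f x i j).
Proof.
move=> oA; elim: k f => [|k IH] f /=.
  move=> cf x Ax.
  apply: (@continuous_comp _ _ _ f (fun M : 'M[R]_(m, n) => M i j)).
    exact: cf.
  exact: coord_continuous.
move=> [df Df]; split=> [x Ax|v].
  apply: (differentiable_comp (g := fun M : 'M[R]_(m, n) => M i j : R)).
    exact: df.
  exact: differentiable_coord.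
apply: (cdiff_on_ext (f := fun x => 'D_v f x i j)) => //; last exact: IH.
by move=> x Ax; rewrite derive_mx ?mxE //; apply: diff_derivable; exact: df.
Qed.

Lemma cdiff_on_mx V m n k (A : set V) (f : V -> 'M[R]_(m, n)) : open A ->
  (forall i j, cdiff_on k A (fun x => f x i j)) -> cdiff_on k A f.
Proof.
move=> oA; have cdiffZl (h : V -> R) (M : 'M[R]_(m, n)) :
    cdiff_on k A h -> cdiff_on k A (fun x => h x *: M).
  elim: k h => [|l IH] h /=.
    by move=> ch x Ax; apply: cvgZr_tmp; exact: ch.
  move=> [dh Dh]; split=> [x Ax|v]; first exact/differentiableZl/dh.
  apply: (cdiff_on_ext (f := fun x => 'D_v h x *: M)) => //; last exact: IH.
  move=> x Ax; have dhx := dh _ Ax.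
  by rewrite !deriveE ?diffZl //; exact: differentiableZl.
move=> cf; apply: (cdiff_on_ext
    (f := fun x => \sum_i \sum_j f x i j *: delta_mx i j)) => //.
  by move=> x _; rewrite -matrix_sum_delta.
by do 2![apply: cdiff_on_sum => // ?]; apply: cdiffZl; exact: cf.
Qed.

End SmoothCalculus.

(* A set with a smooth atlas modelled on R^N. Its topology is the one induced *)
(* by the atlas, see below; Hausdorffness and second countability are not     *)
(* part of the record. [param i] inverts [coord i] on [dom i] and is          *)
(* unconstrained outside [coord i @` dom i]. [chart_at] selects a preferred   *)
(* chart around each point, used only to represent tangent vectors.           *)
Record manifold (R : realType) (N : nat) := Manifold {
  mpoint :> Type;
  chart : Type;
  dom : chart -> set mpoint;
  coord : chart -> mpoint -> 'rV[R]_N;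
  param : chart -> 'rV[R]_N -> mpoint;
  chart_at : mpoint -> chart;
  dom_chart_at : forall p, dom (chart_at p) p;
  coordK : forall i p, dom i p -> param i (coord i p) = p;
  open_overlap : forall i j, open (coord i @` (dom i `&` dom j));
  smooth_transition : forall i j,
    smooth_on (coord i @` (dom i `&` dom j)) (coord j \o param i)
}.

Arguments dom {R N m} i _.
Arguments coord {R N m} i _.
Arguments param {R N m} i _.
Arguments chart_at {R N m} p.
Arguments dom_chart_at {R N m} p.
Arguments coordK {R N m i p} _.
Arguments open_overlap {R N m} i j.
Arguments smooth_transition {R N m} i j _.

Section AtlasTopology.
Context {R : realType} {N : nat} (M : manifold R N).

Definition atlas_open : set (set M) :=
  [set U | forall i, open (coord i @` (U `&` dom i))].

Lemma atlas_openT : atlas_open setT.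
Proof.
by move=> i; rewrite setTI -[dom i]setIid; exact: open_overlap.
Qed.

Lemma atlas_openI : setI_closed atlas_open.
Proof.
move=> U V oU oV i; rewrite (_ : _ @` _ =
    (coord i @` (U `&` dom i)) `&` (coord i @` (V `&` dom i))).
  exact: openI.
apply/seteqP; split=> [_ [p [[Up Vp] ip] <-]|x [[p [Up ip] <-] [q [Vq iq] qp]]].
  by split; exists p.
exists p => //; split=> //; split=> //.
by rewrite -(coordK ip) -qp coordK.
Qed.

Lemma atlas_open_bigcup (I : Type) (f : I -> set M) :
  (forall j, atlas_open (f j)) -> atlas_open (\bigcup_j f j).
Proof.
move=> of_ i; rewrite setI_bigcupl image_bigcup.
by apply: bigcup_open => j _; exact: of_.
Qed.

HB.instance Definition _ := gen_eqMixin (mpoint M).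
HB.instance Definition _ := gen_choiceMixin (mpoint M).
HB.instance Definition _ := isOpenTopological.Build (mpoint M)
  atlas_openT atlas_openI atlas_open_bigcup.

End AtlasTopology.

Unset Implicit Arguments.

Section TangentSpace.
Context {R : realType} {N : nat}.

(* T_p M, identified with R^N through the preferred chart at p.               *)
Definition tangent {M : manifold R N} (p : M) : Type := 'rV[R]_N.

(* The components in the chart [i] of a tangent vector at [p], and conversely *)
(* the tangent vector at [p] with given components in the chart [i].          *)
Definition tangent_coord {M : manifold R N} (i : chart M) (p : M)
    (v : tangent p) : 'rV[R]_N :=
  'd (coord i \o param (chart_at p)) (coord (chart_at p) p) v.

Definition tangent_vec {M : manifold R N} (i : chart M) (p : M)
    (a : 'rV[R]_N) : tangent p :=
  'd (coord (chart_at p) \o param i) (coord i p) a.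

End TangentSpace.

Set Implicit Arguments.

Section Transitions.
Context {R : realType} {N : nat} (M : manifold R N).

Lemma transition_diff (i j : chart M) p : dom i p -> dom j p ->
  differentiable (coord j \o param i) (coord i p).
Proof.
by move=> ip jp; have [+ _] := smooth_transition i j 1; apply; exists p.
Qed.

Lemma transition_comp (i j l : chart M) p a :
  dom i p -> dom j p -> dom l p ->
  'd (coord l \o param j) (coord j p) ('d (coord j \o param i) (coord i p) a) =
  'd (coord l \o param i) (coord i p) a.
Proof.
move=> ip jp lp; apply: diff_comp_at; last 1 first.
- exact: transition_diff.
- by rewrite /= coordK.
- have : nbhs (coord i p) (coord i @` (dom i `&` dom j)).
    by apply: open_nbhs_nbhs; split; [exact: open_overlap|exists p].
  by apply: filterS => _ [q [iq jq] <-] /=; rewrite !coordK.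
- exact: transition_diff.
Qed.

Lemma transition_self (i : chart M) p a : dom i p ->
  'd (coord i \o param i) (coord i p) a = a.
Proof.
move=> ip.
have [|_ E] := @diff_near_eq R _ _ (coord i \o param i) id (coord i p) _
  (transition_diff ip ip).
  have : nbhs (coord i p) (coord i @` (dom i `&` dom i)).
    by apply: open_nbhs_nbhs; split; [exact: open_overlap|exists p].
  by apply: filterS => _ [q [iq _] <-] /=; rewrite coordK.
by rewrite -E diff_val.
Qed.

Lemma tangent_coordK (i : chart M) (p : M) (v : tangent p) :
  dom i p ->
  tangent_vec i p (tangent_coord i p v) = v.
Proof.
move=> ip; have cp := dom_chart_at p.
by rewrite /tangent_vec /tangent_coord transition_comp // transition_self.
Qed.

Lemma tangent_vecK (i : chart M) (p : M) a : dom i p ->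
  tangent_coord i p (tangent_vec i p a) = a.
Proof.
move=> ip; have cp := dom_chart_at p.
by rewrite /tangent_vec /tangent_coord transition_comp // transition_self.
Qed.

End Transitions.

Section TangentBundle.
Context {R : realType} {n : nat} (Q : manifold R n).

Record tbundle_point := TPoint { tbase : Q; tvel : tangent tbase }.

Definition tbundle_dom (i : chart Q) : set tbundle_point := tbase @^-1` dom i.

Definition tbundle_coord (i : chart Q) (p : tbundle_point) : 'rV[R]_(n + n) :=
  row_mx (coord i (tbase p)) (tangent_coord i (tbase p) (tvel p)).

Definition tbundle_param (i : chart Q) (z : 'rV[R]_(n + n)) : tbundle_point :=
  TPoint (tangent_vec i (param i (lsubmx z)) (rsubmx z)).

Lemma tbundle_coordK i p : tbundle_dom i p ->
  tbundle_param i (tbundle_coord i p) = p.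
Proof.
case: p => q v; rewrite /tbundle_dom /= => iq.
rewrite /tbundle_param /tbundle_coord row_mxKl row_mxKr /= coordK //.
by rewrite tangent_coordK.
Qed.

Lemma tbundle_paramK i z : (coord i @` dom i) (lsubmx z) ->
  tbundle_coord i (tbundle_param i z) = z.
Proof.
move=> [q iq qz]; rewrite /tbundle_coord /= -qz coordK // tangent_vecK //.
by rewrite qz hsubmxK.
Qed.

Lemma tbundle_overlap i j :
  tbundle_coord i @` (tbundle_dom i `&` tbundle_dom j) =
  lsubmx @^-1` (coord i @` (dom i `&` dom j)).
Proof.
apply/seteqP; split=> [_ [p [ip jp] <-]|z [q [iq jq] qz]] /=.
  by rewrite row_mxKl; exists (tbase p).
exists (tbundle_param i z); last by apply: tbundle_paramK; exists q.
by split; rewrite /tbundle_dom /= -qz coordK.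
Qed.

Lemma tbundle_open_overlap i j :
  open (tbundle_coord i @` (tbundle_dom i `&` tbundle_dom j)).
Proof.
rewrite tbundle_overlap; apply: open_comp; last exact: open_overlap.
by move=> z _; exact: continuous_lsubmx.
Qed.

Lemma tbundle_transition i j z :
  (coord i @` (dom i `&` dom j)) (lsubmx z) ->
  (tbundle_coord j \o tbundle_param i) z =
  row_mx ((coord j \o param i) (lsubmx z))
    (\sum_(k < n) rsubmx z 0 k *:
       'D_(delta_mx 0 k) (coord j \o param i) (lsubmx z)).
Proof.
move=> [q [iq jq] qz]; rewrite /tbundle_coord /tbundle_param /=; congr row_mx.
rewrite -qz coordK // /tangent_coord /tangent_vec transition_comp //; last first.
  exact: dom_chart_at.
rewrite [X in 'd _ _ X = _](row_sum_delta (rsubmx z)) linear_sum.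
apply: eq_bigr => k _; rewrite linearZ /= deriveE //.
exact: transition_diff.
Qed.

Lemma tbundle_smooth_transition i j :
  smooth_on (tbundle_coord i @` (tbundle_dom i `&` tbundle_dom j))
    (tbundle_coord j \o tbundle_param i).
Proof.
move=> k; rewrite tbundle_overlap; set A := coord i @` _.
have oA : open A by exact: open_overlap.
have cl : continuous (lsubmx : 'rV[R]_(n + n) -> 'rV[R]_n).
  exact: continuous_lsubmx.
have cr : continuous (rsubmx : 'rV[R]_(n + n) -> 'rV[R]_n).
  exact: continuous_rsubmx.
have oTA : open (lsubmx @^-1` A : set 'rV[R]_(n + n)).
  by apply: open_comp => // z _; exact: cl.
apply: (cdiff_on_ext oTA) => [z Az|]; first exact/esym/tbundle_transition.
have Ck := smooth_transition i j.
apply: cdiff_on_mx => // a b; case: (split_ordP b) => c ->.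
  apply: (cdiff_on_ext (f := fun z => (coord j \o param i) (lsubmx z) 0 c)) => //.
    by move=> z _; rewrite (ord1 a) row_mxEl.
  apply: cdiff_on_coord => //.
  exact: (cdiff_on_precomp (L := lsubmx) cl oA (Ck k)).
apply: (cdiff_on_ext (f := fun z => \sum_(l < n) rsubmx z 0 l *
    'D_(delta_mx 0 l) (coord j \o param i) (lsubmx z) 0 c)) => //.
  move=> z _; rewrite (ord1 a) row_mxEr summxE.
  by apply: eq_bigr => l _; rewrite [RHS]mxE.
apply: cdiff_on_sum => // l; apply: cdiff_onM => //; apply: cdiff_on_coord => //.
  have := cdiff_on_precomp (L := rsubmx) cr openT (cdiff_on_id k setT).
  by apply: cdiff_onS.
have [_ Dk] := Ck k.+1.
exact: (cdiff_on_precomp (L := lsubmx) cl oA (Dk (delta_mx 0 l))).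
Qed.

Definition tbundle : manifold R (n + n) :=
  @Manifold R (n + n) tbundle_point (chart Q) tbundle_dom tbundle_coord
    tbundle_param (fun p => chart_at (tbase p))
    (fun p => dom_chart_at (tbase p)) tbundle_coordK tbundle_open_overlap
    tbundle_smooth_transition.

End TangentBundle.

Unset Implicit Arguments.

Section ManifoldCalculus.
Context {R : realType} {N : nat}.

Definition smooth_fun {M : manifold R N} (U : set M) (f : M -> R) : Prop :=
  forall i, smooth_on (coord i @` (U `&` dom i)) (f \o param i).

Definition vfield (M : manifold R N) := forall p : M, tangent p.

Definition smooth_vfield {M : manifold R N} (X : vfield M) : Prop :=
  forall i, smooth_on (coord i @` dom i)
    (fun x => tangent_coord i (param i x) (X (param i x))).

Definition tensor1 (M : manifold R N) := forall p : M, tangent p -> R.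
Definition tensor2 (M : manifold R N) :=
  forall p : M, tangent p -> tangent p -> R.

(* The tangent vector d/dx^k at [p], for the coordinates x of the chart [i].  *)
Definition coord_vec {M : manifold R N} (i : chart M) (p : M)
    (k : 'I_N) : tangent p :=
  tangent_vec i p (delta_mx 0 k).

Definition coef1 {M : manifold R N} (i : chart M) (alpha : tensor1 M) k
    (x : 'rV[R]_N) : R :=
  alpha (param i x) (coord_vec i (param i x) k).

Definition coef2 {M : manifold R N} (i : chart M) (beta : tensor2 M) k l
    (x : 'rV[R]_N) : R :=
  beta (param i x) (coord_vec i (param i x) k) (coord_vec i (param i x) l).

Definition one_form {M : manifold R N} (alpha : tensor1 M) : Prop :=
  (forall p, scalar (alpha p)) /\
  (forall i k, smooth_on (coord i @` dom i) (coef1 i alpha k)).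

Definition mdiff {M : manifold R N} (f : M -> R) : tensor1 M :=
  fun p v => 'd (f \o param (chart_at p)) (coord (chart_at p) p) v.

(* d alpha (d/dx^j, d/dx^k) = d_j alpha_k - d_k alpha_j, computed at [p] in   *)
(* the preferred chart at [p], whose coordinate vectors at [p] are the        *)
(* canonical basis of [tangent p].                                            *)
Definition ext_deriv {M : manifold R N} (alpha : tensor1 M) : tensor2 M :=
  fun p v w => let i := chart_at p in let x := coord i p in
    \sum_(j < N) \sum_(k < N) v 0 j * w 0 k *
      ('D_(delta_mx 0 j) (coef1 i alpha k) x -
       'D_(delta_mx 0 k) (coef1 i alpha j) x).

Definition flat {M : manifold R N} (g : tensor2 M) (p : M)
    (u : tangent p) : tangent p -> R :=
  g p u.

Definition iprod {M : manifold R N} (X : vfield M)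
    (omega : tensor2 M) : tensor1 M :=
  fun p => omega p (X p).

Definition riemannian_metric {M : manifold R N} (g : tensor2 M) : Prop :=
  [/\ forall p u, scalar (g p u),
      forall p u v, g p u v = g p v u,
      forall p (v : tangent p), v <> 0 -> 0 < g p v v &
      forall i k l, smooth_on (coord i @` dom i) (coef2 i g k l)].

Definition smooth_curve {M : manifold R N} (I : set R) (c : R -> M) : Prop :=
  forall i, open (I `&` c @^-1` dom i) /\
    smooth_on (I `&` c @^-1` dom i) (coord i \o c).

(* The curve [c] passes through [p] at time [t], with velocity [w].           *)
Definition has_velocity {M : manifold R N} (c : R -> M) (t : R) (p : M)
    (w : tangent p) : Prop :=
  [/\ c t = p, \forall s \near t, dom (chart_at p) (c s) &
      is_derive t 1 (coord (chart_at p) \o c) w].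

(* T_p S for a submanifold [S] of [M]: velocities of smooth curves in [S].    *)
Definition tangent_sub {M : manifold R N} (S : set M) (p : M) : set
    (tangent p) :=
  [set w | exists e c, [/\ 0 < e, smooth_curve `]- e, e[ c,
     forall t, - e < t < e -> S (c t) & has_velocity c 0 p w]].

Definition integral_curve {M : manifold R N} (X : vfield M) (U : set M)
    (a b : R)
    (c : R -> M) : Prop :=
  forall t, a < t < b -> U (c t) /\ has_velocity c t (c t) (X (c t)).

(* [w1] and [w2] are subspaces whose sum is the whole space and is direct.    *)
Definition transversal_subspaces {W : vectType R} (w1 w2 : set W) : Prop :=
  exists U1 U2 : {vspace W},
    [/\ w1 = [set` U1], w2 = [set` U2], (U1 + U2)%VS = fullv &
        (\dim {:W} = \dim U1 + \dim U2)%N].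

Definition tangent_map {N' : nat} {M : manifold R N} {M' : manifold R N'}
    (F : M -> M') (p : M)
    (v : tangent p) : tangent (F p) :=
  'd (coord (chart_at (F p)) \o F \o param (chart_at p))
     (coord (chart_at p) p) v.

End ManifoldCalculus.

Section Mechanics.
Context {R : realType} {n : nat} {Q : manifold R n}.

Local Notation TQ := (tbundle Q).

Definition tau_proj (p : TQ) : Q := tbase p.

(* In what follows [row_mx a b], with [a b : 'rV_n], stands for the tangent   *)
(* vector a^i d/dq^i + b^i d/dqdot^i of TQ, in the coordinates of TQ induced  *)
(* by the preferred chart at the base point.                                  *)

Definition almost_tangent (p : TQ) (w : tangent p) : tangent p :=
  row_mx 0 (lsubmx w).

Definition almost_tangent_dual (alpha : tensor1 TQ) : tensor1 TQ :=
  fun p w => alpha p (almost_tangent p w).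

Definition vlift (X : vfield Q) : vfield TQ := fun p => row_mx 0 (X (tbase p)).

Definition vlift1 (alpha : tensor1 Q) : tensor1 TQ :=
  fun p w => alpha (tau_proj p) (tangent_map tau_proj p w).

Definition complete_lift (g : tensor2 Q) : tensor2 TQ :=
  fun p u w =>
    let i := chart_at (tbase p) in let x := coord i (tbase p) in
    let a := lsubmx u in let b := rsubmx u in
    let c := lsubmx w in let d := rsubmx w in
    \sum_(j < n) \sum_(k < n)
      ((\sum_(l < n) tvel p 0 l * 'D_(delta_mx 0 l) (coef2 i g j k) x)
         * a 0 j * c 0 k
       + coef2 i g j k x * a 0 j * d 0 k
       + coef2 i g j k x * b 0 j * c 0 k).

Definition mech_lagrangian (g : tensor2 Q) (V : Q -> R) : TQ -> R :=
  fun p => 2^-1 * g (tbase p) (tvel p) (tvel p) - V (tbase p).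

Definition energy (L : TQ -> R) : TQ -> R :=
  fun p => mdiff L p (row_mx 0 (tvel p)) - L p.

Definition omega_of (L : TQ -> R) : tensor2 TQ :=
  fun p v w => - ext_deriv (almost_tangent_dual (mdiff L)) p v w.

Definition euler_lagrange (L : TQ -> R) (G : vfield TQ) : Prop :=
  smooth_vfield G /\
  forall p (w : tangent p), iprod G (omega_of L) p w = mdiff (energy L) p w.

Definition zero_set {m : nat} (phi : 'I_m -> TQ -> R) : set TQ :=
  [set p | forall a, phi a p = 0].

Definition submersive_along_zero_set {m : nat} (phi : 'I_m -> TQ -> R) : Prop :=
  forall p, zero_set phi p -> forall y : 'I_m -> R,
    exists w : tangent p, forall a, mdiff (phi a) p w = y a.

(* The fibre at [p] of the span of the vertical lifts.                        *)
Definition vlift_dist {m : nat} (Y : 'I_m -> vfield Q) (p : TQ) : set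
    (tangent p) :=
  [set w | exists c : 'I_m -> R, w = \sum_(a < m) c a *: vlift (Y a) p].

Definition vlift1_span {m : nat} (f : 'I_m -> tensor1 Q) (p : TQ) :
    set (tangent p -> R) :=
  [set alpha | exists c : 'I_m -> R,
     alpha = fun w => \sum_(a < m) c a * vlift1 (f a) p w].

(* Control functions are given by total functions on TQ of which only the     *)
(* values on [S] are ever used.                                               *)
Definition smooth_extension {m : nat} (S : set TQ) (u : 'I_m -> TQ -> R)
    (U : set TQ)
    (v : 'I_m -> TQ -> R) : Prop :=
  [/\ open U, S `<=` U, forall a, smooth_fun U (v a) &
      forall a p, S p -> v a p = u a p].

Definition control_function {m : nat} (S : set TQ)
    (u : 'I_m -> TQ -> R) : Prop :=
  exists U v, smooth_extension S u U v.

Definition closed_loop {m : nat} (G : vfield TQ) (Y : 'I_m -> vfield Q)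
    (u : 'I_m -> TQ -> R) : vfield TQ :=
  fun p => G p + \sum_(a < m) u a p *: vlift (Y a) p.

Definition makes_invariant {m : nat} (G : vfield TQ) (Y : 'I_m -> vfield Q)
    (S : set TQ) (u : 'I_m -> TQ -> R) : Prop :=
  forall U v, smooth_extension S u U v ->
  forall a b c, a < 0 < b -> integral_curve (closed_loop G Y v) U a b c ->
  S (c 0) -> forall t, a < t < b -> S (c t).

End Mechanics.

(* Main.v *)
Require Import Defs.
From mathcomp Require Import all_boot all_order all_algebra ring lra.
From mathcomp Require Import all_classical reals landau topology normedtype.
From mathcomp Require Import sequences derive.
From mathcomp Require Import measure lebesgue_measure lebesgue_integral ftc.
(* Imported again so that [coord] stands for the coordinates of a chart, not
   for those of a vector in a basis. *)
Require Import Defs.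
Import Order.TTheory GRing.Theory Num.Theory.
Import numFieldNormedType.Exports.

(** The residual [i_Gamma omega_L - dE_L] measures how far [Gamma] is from the
    Euler-Lagrange field, so only the feedback term contributes to it. For a
    vertical vector with base components [b], [omega_L] contracts to minus the
    covector [g b] pulled back to the tangent bundle ([omega_vertical]), and the
    complete lift of the metric contracts to plus the same covector
    ([complete_lift_vertical]). Hence the residual at [p] always is
    [- u_a (f^a)^V], and the flat image of the lifted inputs is the span of the
    [(f^a)^V]. In particular the membership condition on the residual holds for
    every feedback, and both equivalences reduce to one fact
    ([makes_invariantP]): a feedback makes the constraint set invariant if and
    only if the closed-loop field is tangent to it. For the version with
    [tau^*], two tangent closed-loop fields differ by a vertical input vector,
    which transversality forces to be zero ([transversal_diff_eq0]); applying the
    metric, the two combinations of the [(f^a)^V] agree.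

    Necessity of tangency needs smooth integral curves through every point of the
    constraint set, hence the Cauchy-Lipschitz theorem ([cauchy_lipschitz]) and
    smoothness of its solutions ([smooth_along_flow]). Sufficiency
    ([zero_set_invariant]) is proved for the defining map [f] of the constraint in
    a chart. Its derivative [P] along the field vanishes on the zero set and is
    locally Lipschitz. As [f] is a submersion, the distance to the zero set is at
    most a multiple of [`|f|] ([submersion_metric_regularity]), so [`|P|] is also
    at most a multiple of [`|f|], and Gronwall's lemma ([gronwall_near]) keeps
    [f] equal to zero along integral curves. *)

Set Implicit Arguments.
Unset Strict Implicit.
Unset Printing Implicit Defensive.

Local Open Scope classical_set_scope.
Local Open Scope ring_scope.

(** * Mean value estimates *)

Section MeanValue.
Context {R : realType}.

Lemma mx_entry_le_norm m n (A : 'M[R]_(m, n)) i j : `|A i j| <= `|A|.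
Proof.
rewrite [leRHS]/Num.Def.normr /= mx_normrE.
exact: (le_bigmax _ (fun ij => `|A ij.1 ij.2|) (i, j)).
Qed.

Lemma mx_norm_le m n (A : 'M[R]_(m, n)) e : 0 <= e ->
  (forall i j, `|A i j| <= e) -> `|A| <= e.
Proof.
move=> e0 Ae; rewrite [leLHS]/Num.Def.normr /= mx_normrE.
by apply: bigmax_le => // -[i j] _; exact: Ae.
Qed.

Lemma is_derive_entry (V : normedModType R) m n (f : V -> 'M[R]_(m, n)) x v df
    i j :
  is_derive x v f df -> is_derive x v (fun y => f y i j) (df i j).
Proof.
move=> [fd <-]; have fdij := (derivable_mxP f x v).1 fd i j.
by rewrite (derive_mx fd) mxE; exact: derivableP.
Qed.

Lemma is_derive_mx (V : normedModType R) m n (f : V -> 'M[R]_(m, n)) x v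
    (df : 'M[R]_(m, n)) :
  (forall i j, is_derive x v (fun y => f y i j) (df i j)) -> is_derive x v f df.
Proof.
move=> H; have fd : derivable f x v.
  by apply/derivable_mxP => i j; have [] := H i j.
apply: DeriveDef => //; rewrite (derive_mx fd); apply/matrixP => i j.
by rewrite mxE; have [] := H i j.
Qed.

Lemma is_derive_continuous (V : normedModType R) (f : R -> V) (t : R) w :
  is_derive t 1 f w -> {for t, continuous f}.
Proof. by case=> /derivable1_diffP /differentiable_continuous. Qed.

Lemma is_derive_comp (V W : normedModType R) (f : V -> W) (c : R -> V)
    (t : R) w :
  differentiable f (c t) -> is_derive t 1 c w ->
  is_derive t 1 (f \o c) ('d f (c t) w).
Proof.
move=> df [/derivable1_diffP dc <-].
have dfc : differentiable (f \o c) t by exact: differentiable_comp.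
apply: DeriveDef; first by apply/derivable1_diffP.
by rewrite !deriveE // diff_comp.
Qed.

(** The mean value theorem fails for vector-valued maps, but the inequality
    survives entry by entry because the matrix norm is the supremum norm. The
    bound is stated without ordering [a] and [b], since curves are followed in
    both time directions. *)
Lemma mean_value_le m n (f df : R -> 'M[R]_(m, n)) K (a b : R) :
  (forall t, Num.min a b <= t <= Num.max a b ->
     is_derive t 1 f (df t) /\ `|df t| <= K) ->
  `|f b - f a| <= K * `|b - a|.
Proof.
wlog ab : a b / a <= b => [H|].
  have /orP[/H //|ba fdf] := le_total a b.
  by rewrite distrC (distrC b); apply: H => // t; rewrite minC maxC; exact: fdf.
rewrite (min_idPl ab) (max_idPr ab) => fdf.
have K0 : 0 <= K.
  by apply: le_trans (fdf a _).2; rewrite ?normr_ge0 // lexx.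
apply: mx_norm_le => [|i j]; first by rewrite mulr_ge0.
have dij t : a <= t <= b -> is_derive t 1 (fun s => f s i j) (df t i j).
  by move=> /fdf[ft _]; exact: is_derive_entry.
have [||c cab] := @MVT_segment R (fun s => f s i j) (fun s => df s i j) a b ab.
- by move=> t; rewrite in_itv /= => /andP[at_ tb]; apply: dij; rewrite !ltW.
- apply: derivable_within_continuous => t; rewrite in_itv /= => tab.
  by have [] := dij _ tab.
rewrite !mxE => ->; rewrite normrM ler_wpM2r //.
apply: le_trans (mx_entry_le_norm _ _ _) (fdf _ _).2.
by move: cab; rewrite in_itv.
Qed.

Lemma between_dist (a b t : R) : Num.min a b <= t <= Num.max a b ->
  `|t - a| <= `|b - a|.
Proof.
have /orP[ab|ba] := le_total a b.
  rewrite (min_idPl ab) (max_idPr ab) => /andP[at_ tb].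
  by rewrite !ger0_norm ?subr_ge0 // lerD2r.
rewrite (min_idPr ba) (max_idPl ba) => /andP[bt ta].
by rewrite !ler0_norm ?subr_le0 // lerN2 lerD2r.
Qed.

Lemma is_derive_segment (V W : normedModType R) (f : V -> W) x y (t : R) :
  differentiable f (x + t *: (y - x)) ->
  is_derive t 1 (fun s : R => f (x + s *: (y - x)))
    ('d f (x + t *: (y - x)) (y - x)).
Proof.
move=> df.
have H : is_derive t 1 (fun s : R => x + s *: (y - x)) (y - x).
  have -> : (fun s : R => x + s *: (y - x)) = cst x + ( *:%R^~ (y - x)) by [].
  rewrite -[X in is_derive _ _ _ X]add0r; apply: is_deriveD.
  apply: DeriveDef; first exact/derivable1_diffP.
  by rewrite deriveE // diff_val scale1r.
exact: (is_derive_comp (c := fun s : R => x + s *: (y - x))).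
Qed.

Lemma ball_segment (V : normedModType R) (x0 : V) r x y t :
  ball x0 r x -> ball x0 r y -> 0 <= t <= 1 -> ball x0 r (x + t *: (y - x)).
Proof.
rewrite -!ball_normE /= => xr yr /andP[t0 t1].
have -> : x0 - (x + t *: (y - x)) = (1 - t) *: (x0 - x) + t *: (x0 - y).
  rewrite scalerBl scale1r -addrA [- _ + _]addrC -scalerBr.
  by rewrite opprB [x0 - y + _]addrC addrA subrK opprD addrA -scalerN opprB.
have [->|t0'] := eqVneq t 0; first by rewrite subr0 scale1r scale0r addr0.
have {}t0 : 0 < t by rewrite lt_def t0'.
rewrite (le_lt_trans (ler_normD _ _)) // !normrZ (gtr0_norm t0).
rewrite (@ger0_norm _ (1 - t)) ?subr_ge0 //.
rewrite (@lt_le_trans _ _ ((1 - t) * r + t * r)) //; last first.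
  by rewrite -mulrDl subrK mul1r.
by rewrite ler_ltD ?ltr_pM2l // ler_wpM2l ?subr_ge0 // ltW.
Qed.

(** Continuity of the finitely many partial derivatives bounds the
    differential on a ball, and balls are convex, so the mean value inequality
    along segments applies. *)
Lemma cdiff1_lipschitz_near m n (A : set 'rV[R]_m) (f : 'rV[R]_m -> 'rV[R]_n)
    x0 : open A -> A x0 -> cdiff_on 1 A f ->
  exists K r, [/\ 0 <= K, 0 < r, ball x0 r `<=` A &
    forall x y, ball x0 r x -> ball x0 r y -> `|f x - f y| <= K * `|x - y|].
Proof.
move=> oA Ax0 [df Df].
pose e j : 'rV[R]_m := delta_mx 0 j.
pose K := \sum_j (`|'D_(e j) f x0| + 1).
have K0 : 0 <= K by apply: sumr_ge0 => j _; rewrite addr_ge0.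
have : \forall x \near x0,
    A x /\ forall j, `|'D_(e j) f x| <= `|'D_(e j) f x0| + 1.
  have nA : \forall x \near x0, A x by apply: open_nbhs_nbhs; split.
  suff : \forall x \near x0, forall j, `|'D_(e j) f x| <= `|'D_(e j) f x0| + 1.
    by apply: filterS2 nA.
  apply: (@filter_forall _ _
    (fun j x => `|'D_(e j) f x| <= `|'D_(e j) f x0| + 1) (nbhs x0)) => j.
  have /cvg_norm cD : {for x0, continuous ('D_(e j) f)} by exact: Df.
  apply: (@cvgr_le _ _ _ _ _ _ cD).
  by rewrite ltrDl.
move=> /nbhs_ballP[r /= r0 xr]; exists K, r; split=> // [x /xr[]//|x y xb yb].
have dfle z v : ball x0 r z -> `|'d f z v| <= K * `|v|.
  move=> /xr[Az zK]; have dfz := df _ Az.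
  rewrite [X in 'd _ _ X](row_sum_delta v) linear_sum /K mulr_suml.
  apply: le_trans (ler_norm_sum _ _ _) _; apply: ler_sum => j _.
  rewrite linearZ /= normrZ mulrC -deriveE //.
  by rewrite ler_pM // mx_entry_le_norm.
have := @mean_value_le 1 n (fun s => f (y + s *: (x - y)))
  (fun s => 'd f (y + s *: (x - y)) (x - y)) (K * `|x - y|) 0 1.
rewrite scale1r scale0r addr0 subrKC subr0 normr1 mulr1; apply => t.
rewrite (min_idPl _) // (max_idPr _) // => t01.
have yt : ball x0 r (y + t *: (x - y)) by exact: ball_segment.
by split; [apply: is_derive_segment; apply: df; exact: (xr _ yt).1|exact: dfle].
Qed.
End MeanValue.

(** * Growth estimates along curves *)

Section Flows.
Context {R : realType}.

(** On an interval of half-length [e] around [t0], the maximum of [`|h|] is at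
    most [K * e] times itself by the mean value inequality; as soon as
    [K * e <= 1 / 2] it vanishes. *)
Lemma gronwall_near m (h dh : R -> 'rV[R]_m) K (t0 : R) : h t0 = 0 ->
  (\forall t \near t0, is_derive (t : R) 1 h (dh t) /\ `|dh t| <= K * `|h t|) ->
  \forall t \near t0, h t = 0.
Proof.
move=> h0 /nbhs_ballP[r /= r0 hr].
pose k := `|K| + 1; have k0 : 0 < k by rewrite ltr_pwDr.
pose e := Num.min (r / 2) (k^-1 / 2).
have e0 : 0 < e by rewrite lt_min !divr_gt0 // invr_gt0.
have hI (t : R) : `|t - t0| <= e ->
    is_derive t 1 h (dh t) /\ `|dh t| <= k * `|h t|.
  move=> te; have [|dt dle] := hr t.
    rewrite -ball_normE /= distrC (le_lt_trans te) // gt_min; apply/orP; left.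
    by rewrite ltr_pdivrMr // ltr_pMr // ltr1n.
  split=> //; apply: le_trans dle _; rewrite ler_wpM2r //.
  by rewrite (le_trans (ler_norm _)) // lerDl.
have [||c cI cmax] := @EVT_max R (fun t => `|h t|) (t0 - e) (t0 + e).
- by rewrite lerD2l ge0_cp // ltW.
- apply: continuous_in_subspaceT => t; rewrite inE /= in_itv /= -ler_distl => te.
  have [dt _] := hI _ te.
  by apply: cvg_norm; exact: is_derive_continuous dt.
have ce : `|c - t0| <= e by move: cI; rewrite in_itv /= ler_distl.
have hc : `|h c - h t0| <= (k * `|h c|) * `|c - t0|.
  apply: (mean_value_le (df := dh)) => t tI.
  have te : `|t - t0| <= e by apply: le_trans ce; exact: between_dist.
  have [dt dle] := hI _ te; split=> //; apply: le_trans dle _.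
  apply: ler_wpM2l; first exact: ltW.
  by apply: cmax; rewrite in_itv /= -ler_distl.
have hc0 : `|h c| <= 0.
  have : `|h c| <= `|h c| / 2.
    rewrite h0 subr0 in hc; apply: le_trans hc _.
    rewrite mulrAC mulrC; apply: ler_wpM2l => //.
    apply: (@le_trans _ _ (k * (k^-1 / 2))).
      apply: ler_wpM2l; first exact: ltW.
      by rewrite (le_trans ce) // ge_min lexx orbT.
    by rewrite mulrA divff ?gt_eqF // mul1r.
  by lra.
apply/nbhs_ballP; exists e => //= t; rewrite -ball_normE /= distrC => /ltW te.
apply/eqP; rewrite -normr_le0; apply: le_trans hc0.
by apply: cmax; rewrite in_itv /= -ler_distl.
Qed.

(** First-order expansion along a ray, in the one-sided form needed to move a
    short positive time in a descent direction. *)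
Lemma derive_near_le (V W : normedModType R) (f : V -> W) x v e :
  derivable f x v -> 0 < e ->
  \forall t \near (0 : R)^'+, `|f (x + t *: v) - f x - t *: 'D_v f x| <= e * t.
Proof.
move=> df e0.
have /derivable_nbhs H := df.
have H0 : \forall t \near (0 : R),
    `|f (x + t *: v) - f x - t *: 'D_v f x| <= e * `|t|.
  have /eqaddoP /(_ e e0) := H.
  apply: filterS => t /=; rewrite !fctE /= opprD addrA addrC.
  by rewrite (addrC (t *: v)) [- (t *: _) + _]addrC.
near=> t.
have t0 : 0 < t by near: t; exact: nbhs_right_gt.
rewrite -[in leRHS](gtr0_norm t0); near: t.
exact: cvg_within H0.
Unshelve. all: by end_near. Qed.

End Flows.

(** * Distance to the zero set of a submersion *)

Section MR.
Context {R : realType}.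

Lemma continuous_norm_at (T : topologicalType) (V : normedModType R)
    (f : T -> V) x :
  {for x, continuous f} -> {for x, continuous (fun y => `|f y|)}.
Proof. exact: cvg_norm. Qed.

(** Metric regularity of submersions: the value controls the distance to the
    zero set. On a compact ball, let
    [y] minimise [`|f y| + d * `|y - x|], Ekeland's penalised functional. Were
    [f y] nonzero, moving from [y] against an approximate preimage of [f y] under
    the differential would decrease [`|f|] faster than it increases the penalty.
    Hence [f y = 0], and comparison with the value at [x] bounds [`|x - y|]. *)
Lemma submersion_metric_regularity m N (A : set 'rV[R]_N)
    (f : 'rV[R]_N -> 'rV[R]_m) x0 r0 :
  open A -> A x0 -> cdiff_on 1 A f -> f x0 = 0 ->
  (forall y, exists w, 'd f x0 w = y) -> 0 < r0 ->
  exists2 C, 0 <= C & \forall x \near x0,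
    exists z, [/\ ball x0 r0 z, A z, f z = 0 & `|x - z| <= C * `|f x|].
Proof.
move=> oA Ax0 [df Df] fx0 sf r00.
have [w wE] := choice (fun j => sf (delta_mx 0 j)).
pose b := \sum_j `|w j| + 1.
have b0 : 0 < b by rewrite ltr_pwDr // sumr_ge0.
pose err x := \sum_j `|'D_(w j) f x - delta_mx 0 j|.
have cerr : {for x0, continuous err}.
  suff : cdiff_on 0 A err by exact.
  apply: cdiff_on_sum => // j x Ax; apply: continuous_norm_at.
  exact: (continuousB (Df (w j) x Ax) (@cst_continuous _ _ _ x)).
have err0 : err x0 = 0.
  rewrite /err big1 // => j _.
  by rewrite deriveE ?wE ?subrr ?normr0 //; exact: df.
have : \forall x \near x0, A x /\ err x < 2^-1.
  have nA : \forall x \near x0, A x by apply: open_nbhs_nbhs; split.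
  suff : \forall x \near x0, err x < 2^-1 by apply: filterS2 nA.
  by apply: (@cvgr_lt _ _ _ _ _ _ cerr); rewrite err0 invr_gt0.
move=> /nbhs_ballP[r1 /= r10 xr1].
pose r := Num.min r0 r1 / 2.
have rmin0 : 0 < Num.min r0 r1 by rewrite lt_min r00.
have r_gt0 : 0 < r by rewrite divr_gt0.
have rlt : r < Num.min r0 r1 by rewrite ltr_pdivrMr // ltr_pMr // ltr1n.
pose K := closed_ball_ Num.norm x0 r.
have KA y : K y -> [/\ ball x0 r0 y, A y & err y < 2^-1].
  move=> Ky; have yr : `|x0 - y| < Num.min r0 r1 by exact: le_lt_trans rlt.
  have [|Ay ey] := xr1 y.
    by rewrite -ball_normE /= (lt_le_trans yr) // ge_min lexx orbT.
  by split=> //; rewrite -ball_normE /= (lt_le_trans yr) // ge_min lexx.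
have cK : compact K.
  apply: bounded_closed_compact; last exact: closed_closed_ball_.
  exists (`|x0| + r); split; first exact: num_real.
  move=> M MK y Ky; apply: le_trans (ltW MK).
  have -> : y = x0 - (x0 - y) by rewrite subKr.
  by rewrite (le_trans (ler_normB _ _)) // lerD2l.
have K0 : K !=set0 by exists x0; rewrite /K /closed_ball_ /= subrr normr0 ltW.
(* With this [d], the displacement [v] below, of norm at most [b * `|f y|],
   raises the penalty by at most a quarter of [`|f y|] per unit of time, while
   [`|f|] falls at half that value or more, up to the first-order error. *)
pose d := (4 * b)^-1.
have d0 : 0 < d by rewrite invr_gt0 mulr_gt0.
have cf y : A y -> {for y, continuous f}.
  by move=> /df; exact: differentiable_continuous.
exists d^-1; first by rewrite invr_ge0 ltW.
have : \forall x \near x0, `|x0 - x| < r / 2 /\ `|f x| < d * (r / 2).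
  have h1 : \forall x \near x0, `|x0 - x| < r / 2.
    apply/nbhs_ballP; exists (r / 2); first by rewrite /= divr_gt0.
    by move=> y; rewrite -ball_normE.
  have /cvg_norm cn := cf _ Ax0.
  apply: filterS2 h1 (@cvgr_lt _ _ _ _ _ _ cn (d * (r / 2)) _) => //.
  by rewrite fx0 normr0 mulr_gt0 // divr_gt0.
apply: filterS => x [xr fxr].
pose h y := `|f y| + d * `|y - x|.
have ch : {within K, continuous h}.
  apply: continuous_in_subspaceT => y; rewrite inE => Ky.
  have [_ Ay _] := KA _ Ky.
  have c2 : {for y, continuous (fun z : 'rV[R]_N => z - x)}.
    by apply: continuousB; [exact: cvg_id|exact: cst_continuous].
  have c1 := continuous_norm_at (cf _ Ay); have {}c2 := continuous_norm_at c2.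
  exact: (cvgD c1 (cvgM (cvg_cst d) c2)).
have [y + ymin] := EVT_min_rV K0 cK ch.
rewrite inE => Ky; have [y0r Ay ey] := KA _ Ky.
have yx : d * `|x - y| <= `|f x|.
  have Kx : x \in K.
    rewrite inE /K /closed_ball_ /= ltW // (lt_trans xr) //.
    by rewrite ltr_pdivrMr // ltr_pMr // ltr1n.
  have := ymin _ Kx; rewrite /h subrr normr0 mulr0 addr0 distrC; apply: le_trans.
  by rewrite lerDr.
exists y; split=> //; last first.
  by rewrite ler_pdivlMl.
have y_int : `|x0 - y| < r.
  have -> : x0 - y = (x0 - x) + (x - y) by rewrite addrA subrK.
  rewrite (le_lt_trans (ler_normD _ _)) // [X in _ < X]splitr ltrD //.
  by rewrite -(ltr_pM2l d0) (le_lt_trans yx).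
apply: contrapT => /eqP fy0.
pose F := `|f y|; have F0 : 0 < F by rewrite normr_gt0.
(* A preimage of [- f y] under the differential at [x0]; under the one at the
   nearby point [y] its image is off by at most half of [`|f y|]. *)
pose v := - \sum_j f y 0 j *: w j.
have vle : `|v| <= b * F.
  rewrite normrN mulrDl mul1r (le_trans (ler_norm_sum _ _ _)) //.
  rewrite (@le_trans _ _ ((\sum_j `|w j|) * F)) //; last by rewrite lerDl ltW.
  rewrite mulr_suml; apply: ler_sum => j _; rewrite normrZ mulrC.
  by apply: ler_wpM2l => //; exact: mx_entry_le_norm.
have Dv : `|'D_v f y + f y| <= F / 2.
  have dfy := df _ Ay.
  have -> : 'D_v f y + f y = - \sum_j f y 0 j *: ('D_(w j) f y - delta_mx 0 j).
    rewrite deriveE // linearN linear_sum -[X in _ + X]opprK -opprD; congr (- _).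
    under [RHS]eq_bigr do rewrite scalerBr.
    rewrite sumrB; congr (_ - _); last exact: row_sum_delta.
    by apply: eq_bigr => j _; rewrite linearZ /= deriveE.
  rewrite normrN (le_trans (ler_norm_sum _ _ _)) //.
  apply: (@le_trans _ _ (F * err y)); last by apply: ler_wpM2l; rewrite ?ltW.
  rewrite mulr_sumr; apply: ler_sum => j _; rewrite normrZ.
  by apply: ler_wpM2r => //; exact: mx_entry_le_norm.
have F8 : 0 < F / 8 by rewrite divr_gt0.
have dfv := derive_near_le (diff_derivable (v := v) (df _ Ay)) F8.
pose s := (r - `|x0 - y|) / (b * F).
have bF : 0 < b * F by rewrite mulr_gt0.
have s0 : 0 < s by rewrite divr_gt0 // subr_gt0.
near (0 : R)^'+ => t.
have t0 : 0 < t by near: t; exact: nbhs_right_gt.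
have t1 : t <= 1 by near: t; apply: nbhs_right_le.
have ts : t <= s by near: t; apply: nbhs_right_le.
have tf : `|f (y + t *: v) - f y - t *: 'D_v f y| <= F / 8 * t by near: t.
have tv : `|t *: v| <= t * (b * F).
  by rewrite normrZ (gtr0_norm t0); apply: ler_wpM2l => //; exact: ltW.
have Kt : y + t *: v \in K.
  rewrite inE /K /closed_ball_ /= opprD addrA (le_trans (ler_normB _ _)) //.
  rewrite -lerBrDl (le_trans tv) //.
  by rewrite -ler_pdivlMr.
have := ymin _ Kt; rewrite /h -/F => hmin.
have fle : `|f (y + t *: v)| <= (1 - t) * F + t * (F / 2) + F / 8 * t.
  have -> : f (y + t *: v) = ((1 - t) *: f y + t *: ('D_v f y + f y)) +
      (f (y + t *: v) - f y - t *: 'D_v f y).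
    have -> : (1 - t) *: f y + t *: ('D_v f y + f y) = f y + t *: 'D_v f y.
      by rewrite scalerBl scale1r scalerDr [t *: _ + t *: _]addrC addrA subrK.
    by rewrite -[f (y + _) - _ - _]addrA -opprD [RHS]addrC subrK.
  rewrite (le_trans (ler_normD _ _)) // lerD // (le_trans (ler_normD _ _)) //.
  rewrite !normrZ (gtr0_norm t0) (@ger0_norm _ (1 - t)) ?subr_ge0 //.
  by rewrite lerD // ler_wpM2l // ltW.
have xle : d * `|y + t *: v - x| <= d * `|y - x| + t * (F / 4).
  have -> : t * (F / 4) = d * (t * (b * F)).
    by rewrite /d; field; rewrite gt_eqF.
  rewrite -mulrDr; apply: ler_wpM2l; first exact: ltW.
  by rewrite addrAC (le_trans (ler_normD _ _)) // lerD2l.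
have tF : 0 < t * F by rewrite mulr_gt0.
move: hmin fle xle tF; move: (d * _) (d * _) `|f (y + _)|; rewrite -/F.
by clear -R; move: (F) (t) => F' t' p q s *; lra.
Unshelve. all: by end_near. Qed.
End MR.

(** * The Cauchy-Lipschitz theorem *)

Section ODE.
Context {R : realType}.

Lemma antiderivative (f : R -> R) (e : R) : 0 < e -> continuous f ->
  exists2 F : R -> R, F 0 = 0 & forall t : R, `|t| < e -> is_derive t 1 F (f t).
Proof.
move=> e0 cf.
pose F0 x := (\int[lebesgue_measure]_(t in `[(- e)%R, x]) f t)%R.
have intf : lebesgue_measure.-integrable `[(- e)%R, e]
    (constructive_ereal.EFin \o f).
  apply: continuous_compact_integrable; first exact: segment_compact.
  exact: continuous_subspaceT.
exists (F0 - cst (F0 0)) => [|t te]; first by rewrite fctE subrr.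
have [dF Fe] : derivable F0 t 1 /\ F0^`()%classic t = f t.
  move: te; rewrite ltr_norml => /andP[et te].
  exact: (continuous_FTC1_closed te intf et (cf t)).
rewrite -[f t]subr0; apply: is_deriveB.
by apply: DeriveDef => //; rewrite -derive1E.
Qed.

Lemma antiderivative_rV N (f : R -> 'rV[R]_N) (e : R) : 0 < e -> continuous f ->
  exists2 F : R -> 'rV[R]_N, F 0 = 0 &
    forall t : R, `|t| < e -> is_derive t 1 F (f t).
Proof.
move=> e0 cf.
have cfj j : continuous (fun t => f t 0 j).
  move=> t; apply: (@continuous_comp _ _ _ f (fun M : 'rV[R]_N => M 0 j)).
    exact: cf.
  exact: coord_continuous.
have /choice[F FE] j : exists F : R -> R, F 0 = 0 /\
    forall t : R, `|t| < e -> is_derive t 1 F (f t 0 j).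
  by have [F F0 dF] := antiderivative e0 (cfj j); exists F.
exists (fun t => \row_j F j t) => [|t te].
  by apply/rowP => j; rewrite !mxE (FE j).1.
apply: is_derive_mx => i j; rewrite ord1.
under eq_fun do rewrite mxE.
exact: (FE j).2.
Qed.

(** One Picard step. The antiderivative is frozen outside [[- e, e]] by
    composing it with the projection onto that interval: it is then continuous
    and bounded by [B * e] on the whole line, so that all Picard iterates stay in
    one ball without any restriction on time. *)
Lemma bounded_antiderivative N (g : R -> 'rV[R]_N) (B e : R) :
    0 < e -> continuous g ->
    (forall t, `|g t| <= B) ->
  exists y : R -> 'rV[R]_N, [/\ continuous y, y 0 = 0,
    forall t, `|y t| <= B * e & forall t : R, `|t| < e -> is_derive t 1 y (g t)].
Proof.
move=> e0 cg gB.
have B0 : 0 <= B by apply: le_trans (gB 0).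
(* The antiderivative is taken on a larger interval so that it is still
   differentiable at the end points of the smaller one. *)
have e2 : e < 2 * e by rewrite ltr_pMl // ltr1n.
have [F F0 dF] := antiderivative_rV (lt_trans e0 e2) cg.
pose cl (t : R) := Num.max (- e) (Num.min e t).
have cle t : `|cl t| <= e.
  rewrite ler_norml le_max lexx /= ge_max ge_min lexx andbT.
  by rewrite (@le_trans _ _ 0) ?oppr_le0 ?ltW.
have cl_id t : `|t| <= e -> cl t = t.
  by rewrite ler_norml => /andP[te et]; rewrite /cl (min_idPr et) (max_idPr te).
have dFcl (t : R) : is_derive (cl t) 1 F (g (cl t)).
  by apply: dF; exact: le_lt_trans e2.
exists (F \o cl); split.
- move=> t; apply: continuous_comp; last exact: is_derive_continuous (dFcl t).
  apply: (@continuous_max _ _ (cst (- e)) (fun t => Num.min e t)).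
    exact: cst_continuous.
  by apply: (@continuous_min _ _ (cst e) id); [exact: cst_continuous|exact: cvg_id].
- by rewrite /= cl_id // normr0 ltW.
- move=> t /=; rewrite -[F _]subr0 -F0.
  apply: (@le_trans _ _ (B * `|cl t - 0|)).
    apply: (mean_value_le (df := g)) => s sI; split=> //; apply: dF.
    have := between_dist sI; rewrite !subr0 => /le_trans /(_ (cle t)).
    by move=> /le_lt_trans; apply.
  by rewrite subr0; apply: ler_wpM2l.
- move=> t te.
  apply: (@near_eq_is_derive _ _ _ F); last by apply: dF; exact: lt_trans e2.
  have : \forall s \near t, `|s| < e.
    exact: (@cvgr_lt _ _ _ _ _ _ (norm_continuous (x := t))).
  by apply: filterS => s /ltW se /=; rewrite cl_id.
Qed.

Lemma geometric_cvg N (u : nat -> 'rV[R]_N) (C : R) :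
  (forall k, `|u k.+1 - u k| <= C * 2^-1 ^+ k) -> cvgn u.
Proof.
move=> uC.
have cn : cvgn [normed series (telescope u)].
  apply: (@series_le_cvg _ _ (geometric C 2^-1)) => [k|k|k|] //.
  - exact: normr_ge0.
  - exact: le_trans (normr_ge0 _) (uC k).
  - exact: uC.
  - apply: is_cvg_geometric_series.
    by rewrite ger0_norm ?invr_ge0 // invf_lt1 // ltr1n.
have cs : cvgn (series (telescope u)).
  move: cn => /cauchy_cvgP/cauchy_seriesP cn.
  apply/cauchy_cvgP/cauchy_seriesP => e /cn.
  apply: filterS => k /=; rewrite ger0_norm ?sumr_ge0 //.
  by apply: le_lt_trans; apply: ler_norm_sum.
have -> : u = cst (u 0) + series (telescope u).
  by apply/funext => k; rewrite fctE -eq_sum_telescope.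
by apply: is_cvgD => //; exact: is_cvg_cst.
Qed.

(** Recognises the derivative of a pointwise limit of curves: a second-order
    remainder estimate, unlike differentiability, passes to the limit. *)
Lemma quadratic_is_derive N (y : R -> 'rV[R]_N) (s : R) w C :
  (\forall t \near s, `|y t - y s - (t - s) *: w| <= C * `|t - s| ^+ 2) ->
  is_derive s 1 y w.
Proof.
move=> H.
have yw : h^-1 *: ((y \o shift s) (h *: 1) - y s) @[h --> 0^'] --> w.
  apply/cvgrPdist_le => e e0.
  have H0 : \forall h \near 0, `|y (h + s) - y s - h *: w| <= C * `|h| ^+ 2.
    move: H; rewrite (near_shift 0) subr0.
    by apply: filterS => h /=; rewrite addrK.
  near=> h.
  have h0 : h != 0 by near: h; exact: nbhs_dnbhs_neq.
  have hC : `|y (h + s) - y s - h *: w| <= C * `|h| ^+ 2.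
    by near: h; exact: cvg_within H0.
  have hd : `|h| <= e / (`|C| + 1).
    by near: h; apply: dnbhs0_le; rewrite divr_gt0 // ltr_pwDr.
  rewrite /= [_%:A]mulr1 distrC.
  rewrite -[w]scale1r -(mulVf h0) -scalerA -scalerBr normrZ normfV.
  rewrite ler_pdivrMl ?normr_gt0 // (le_trans hC) // expr2 mulrA mulrC.
  apply: ler_wpM2l => //.
  rewrite (@le_trans _ _ ((`|C| + 1) * `|h|)) //.
    by apply: ler_wpM2r => //; rewrite (le_trans (ler_norm _)) // lerDl.
  by rewrite mulrC -ler_pdivlMr // ltr_pwDr.
apply: DeriveDef; first by apply/cvg_ex; exists w.
exact: cvg_lim.
Unshelve. all: by end_near. Qed.

(** Picard iteration on a time interval so short that the iterates stay in the
    ball and their differences are halved at each step. Each iterate satisfies a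
    second-order Taylor estimate with constants independent of the iterate, so
    the limit does too, and is a solution by [quadratic_is_derive]. *)
Lemma cauchy_lipschitz N (F : 'rV[R]_N -> 'rV[R]_N) x0 (r K B : R) :
    0 < r -> 0 <= K ->
    (forall x, `|x - x0| <= r -> `|F x| <= B) ->
    (forall x y, `|x - x0| <= r -> `|y - x0| <= r ->
      `|F x - F y| <= K * `|x - y|) ->
  exists (e : R) (y : R -> 'rV[R]_N), [/\ 0 < e, y 0 = x0 &
    forall t : R, `|t| < e -> `|y t - x0| <= r /\ is_derive t 1 y (F (y t))].
Proof.
move=> r0 K0 FB FK.
have B0 : 0 <= B by apply: le_trans (FB x0 _) => //; rewrite subrr normr0 ltW.
(* The first bound keeps the iterates in the ball, the second one makes the
   iteration a contraction of ratio one half; the added units only keep the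
   denominators positive. *)
pose e := Num.min (r / (B + 1)) (2^-1 / (K + 1)).
have e0 : 0 < e by rewrite lt_min !divr_gt0 ?ltr_pwDr ?invr_gt0 //.
have Be : B * e <= r.
  apply: (@le_trans _ _ ((B + 1) * (r / (B + 1)))); last first.
    by rewrite mulrC divfK // gt_eqF // ltr_pwDr.
  by apply: ler_pM; rewrite ?lerDl ?(ltW e0) // ge_min lexx.
have Ke : K * e <= 2^-1.
  apply: (@le_trans _ _ ((K + 1) * (2^-1 / (K + 1)))); last first.
    by rewrite mulrC divfK // gt_eqF // ltr_pwDr.
  by apply: ler_pM; rewrite ?lerDl ?(ltW e0) // ge_min lexx orbT.
pose P (y : R -> 'rV[R]_N) := continuous y /\ forall t, `|y t - x0| <= r.
have /choice[S SP] (y : R -> 'rV[R]_N) : exists z : R -> 'rV[R]_N, P y ->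
    [/\ P z, z 0 = x0 & forall t : R, `|t| < e -> is_derive t 1 z (F (y t))].
  have [[cy yr]|nP] := pselect (P y); last by exists y => /nP.
  have cFy : continuous (F \o y).
    move=> t; apply/cvgrPdist_le => d d0 /=.
    have /cvgrPdist_le /(_ (d / (K + 1))) := cy t.
    rewrite divr_gt0 ?ltr_pwDr // => /(_ isT); apply: filterS => s ys.
    apply: le_trans (FK _ _ (yr t) (yr s)) _.
    apply: (@le_trans _ _ ((K + 1) * (d / (K + 1)))); last first.
      by rewrite mulrC divfK // gt_eqF // ltr_pwDr.
    by apply: ler_pM; rewrite ?lerDl.
  have [z [cz z0 zB dz]] := bounded_antiderivative e0 cFy (fun t => FB _ (yr t)).
  exists (cst x0 + z) => _; split.
  - split=> [t|t]; first by apply: cvgD; [exact: cvg_cst|exact: cz].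
    by rewrite (_ : _ - _ = z t) ?(le_trans (zB t)) // !fctE addrAC subrr add0r.
  - by rewrite !fctE z0 addr0.
  - move=> t te; rewrite -[X in is_derive _ _ _ X]add0r.
    by apply: is_deriveD; exact: dz.
pose u k := iter k S (cst x0).
have uP k : P (u k).
  elim: k => [|k /SP[]//].
  by split=> t; [exact: cvg_cst|rewrite subrr normr0 ltW].
have u0 k : u k 0 = x0 by case: k => //= k; have [] := SP _ (uP k).
have du k (t : R) : `|t| < e -> is_derive t 1 (u k.+1) (F (u k t)).
  by have [_ _] := SP _ (uP k); apply.
have between_lt (a b s : R) : `|a| < e -> `|b| < e ->
    Num.min a b <= s <= Num.max a b -> `|s| < e.
  rewrite !ltr_norml => /andP[ea ae] /andP[eb be] /andP[abs sab].
  apply/andP; split; first by apply: lt_le_trans abs; rewrite lt_min ea.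
  by apply: le_lt_trans sab _; rewrite gt_max ae.
have e00 : `|0 : R| < e by rewrite normr0.
have u_geo k t : `|t| < e -> `|u k.+1 t - u k t| <= (2 * r) * 2^-1 ^+ k.
  elim: k t => [|k IH] t te.
    have -> : u 1 t - u 0 t = (u 1 t - x0) - (u 0 t - x0).
      by rewrite opprB addrA subrK.
    rewrite expr0 mulr1 mulrDl mul1r (le_trans (ler_normB _ _)) // lerD //.
      exact: (uP 1).2.
    exact: (uP 0).2.
  have := @mean_value_le R 1 N (u k.+2 - u k.+1)
    (fun s => F (u k.+1 s) - F (u k s)) (K * ((2 * r) * 2^-1 ^+ k)) 0 t.
  rewrite !fctE !u0 !subrr !subr0 => H; apply: le_trans (H _) _ => [s st|].
    have se := between_lt _ _ _ e00 te st.
    split; first by apply: is_deriveB; exact: du.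
    apply: le_trans (FK _ _ ((uP _).2 _) ((uP _).2 _)) _.
    by apply: ler_wpM2l => //; exact: IH.
  have D0 : 0 <= 2 * r * 2^-1 ^+ k.
    by rewrite !mulr_ge0 ?exprn_ge0 ?invr_ge0 // ltW.
  rewrite exprSr [leRHS]mulrA mulrAC [leRHS]mulrC.
  apply: ler_wpM2r => //; apply: le_trans Ke.
  by apply: ler_wpM2l => //; exact: ltW.
have /choice[y yE] (t : R) : exists l : 'rV[R]_N,
    `|t| < e -> u k t @[k --> \oo] --> l.
  have [te|] := boolP (`|t| < e); last by exists 0.
  have /cvg_ex[l ul] := geometric_cvg (fun k => u_geo k t te).
  by exists l.
have yr t : `|t| < e -> `|y t - x0| <= r.
  move=> te; apply: (@cvgr_to_le _ \oo _ _ (fun k => `|u k t - x0|)).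
    exact: cvg_norm (cvgB (yE t te) (cvg_cst x0)).
  by near=> k; exact: (uP k).2.
have Fy t : `|t| < e -> F (u k t) @[k --> \oo] --> F (y t).
  move=> te; apply/cvgrPdist_le => d d0.
  have /cvgrPdist_le /(_ (d / (K + 1))) := yE t te.
  rewrite divr_gt0 ?ltr_pwDr // => /(_ isT); apply: filterS => k uk.
  apply: le_trans (FK _ _ (yr t te) ((uP k).2 t)) _.
  apply: (@le_trans _ _ ((K + 1) * (d / (K + 1)))); last first.
    by rewrite mulrC divfK // gt_eqF // ltr_pwDr.
  by apply: ler_pM; rewrite ?lerDl.
exists e, y; split=> //.
  have ucst : (fun k => u k 0) = cst x0 by apply/funext => k; exact: u0.
  have := yE 0 e00; rewrite ucst => y0.
  exact: (cvg_unique (@norm_hausdorff _ _) y0 (cvg_cst x0)).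
move=> s se; split; first exact: yr.
have quad k t : `|t| < e ->
    `|u k.+2 t - u k.+2 s - (t - s) *: F (u k.+1 s)| <= K * B * `|t - s| ^+ 2.
  move=> te.
  have u_lip (a b : R) : `|a| < e -> `|b| < e ->
      `|u k.+1 b - u k.+1 a| <= B * `|b - a|.
    move=> ae be; apply: (mean_value_le (df := fun s => F (u k s))) => c cI.
    split; first by apply: du; exact: between_lt cI.
    exact: FB _ ((uP k).2 _).
  set w := F (u k.+1 s).
  have -> : u k.+2 t - u k.+2 s - (t - s) *: w =
      (u k.+2 t - t *: w) - (u k.+2 s - s *: w).
    by rewrite scalerBl !opprB addrACA [RHS]addrACA [- _ - _]addrC.
  rewrite expr2 mulrA -(mulrA K B).
  apply: (@mean_value_le R 1 N (u k.+2 - ( *:%R^~ w))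
    (fun a => F (u k.+1 a) - w)) => a aI.
  have ae := between_lt _ _ _ se te aI; split.
    apply: is_deriveB; first exact: du.
    apply: DeriveDef; first exact/derivable1_diffP.
    by rewrite deriveE // diff_val scale1r.
  apply: le_trans (FK _ _ ((uP _).2 _) ((uP _).2 _)) _.
  apply: ler_wpM2l => //.
  apply: le_trans (u_lip _ _ se ae) _.
  by apply: ler_wpM2l => //; exact: between_dist.
apply: (@quadratic_is_derive _ _ _ _ (K * B)).
have ne : \forall t \near s, `|t| < e.
  exact: (@cvgr_lt _ _ _ _ _ _ (norm_continuous (x := s))).
apply: filterS ne => t te.
apply: (@cvgr_to_le _ \oo _ _
  (fun k => `|u k.+2 t - u k.+2 s - (t - s) *: F (u k.+1 s)|)); last first.
  by near=> k; exact: quad.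
have u_shift p a : `|a| < e -> u (k + p)%N a @[k --> \oo] --> y a.
  by move=> ae; rewrite (cvg_shiftn p (fun k => u k a)); exact: yE.
have F_shift : F (u k.+1 s) @[k --> \oo] --> F (y s).
  by rewrite (cvg_shiftS (fun k => F (u k s))); exact: Fy.
have u2 a : `|a| < e -> u k.+2 a @[k --> \oo] --> y a.
  by move=> /(u_shift 2); under eq_fun do rewrite addn2.
have c2 : (t - s) *: F (u k.+1 s) @[k --> \oo] --> (t - s) *: F (y s).
  exact: cvgZl_tmp.
exact: cvg_norm (cvgB (cvgB (u2 _ te) (u2 _ se)) c2).
Unshelve. all: by end_near. Qed.

End ODE.

(** * Smoothness of solutions *)

Section Flow.
Context {R : realType}.

Lemma local_solution N (A : set 'rV[R]_N) (F : 'rV[R]_N -> 'rV[R]_N) x0 :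
  open A -> A x0 -> cdiff_on 1 A F ->
  exists (e : R) (y : R -> 'rV[R]_N), [/\ 0 < e, y 0 = x0 &
    forall t : R, `|t| < e -> A (y t) /\ is_derive t 1 y (F (y t))].
Proof.
move=> oA Ax0 cF; have [K [r [K0 r0 rA FK]]] := cdiff1_lipschitz_near oA Ax0 cF.
have r20 : 0 < r / 2 by rewrite divr_gt0.
have inr x : `|x - x0| <= r / 2 -> ball x0 r x.
  move=> xr; rewrite -ball_normE /= distrC (le_lt_trans xr) //.
  by rewrite ltr_pdivrMr // ltr_pMr // ltr1n.
have x0r : ball x0 r x0 by exact: ballxx.
have [||e [y [e0 y0 yP]]] :=
    @cauchy_lipschitz R N F x0 (r / 2) K (`|F x0| + K * (r / 2)) r20 K0.
- move=> x xr; have -> : F x = F x0 + (F x - F x0) by rewrite addrC subrK.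
  rewrite (le_trans (ler_normD _ _)) // lerD2l.
  by apply: le_trans (FK _ _ (inr _ xr) x0r) _; apply: ler_wpM2l.
- by move=> x z xr zr; apply: FK; exact: inr.
- exists e, y; split=> // t /yP[yr dy]; split=> //.
  exact/rA/inr.
Qed.

Lemma smooth_on_derive N (A : set 'rV[R]_N) (W : normedModType R)
    (h : 'rV[R]_N -> W) v :
  smooth_on A h -> smooth_on A ('D_v h).
Proof. by move=> sh k; have [_] := sh k.+1; apply. Qed.

Lemma smooth_on_diff N m (A : set 'rV[R]_N) (h : 'rV[R]_N -> 'rV[R]_m)
    (F : 'rV[R]_N -> 'rV[R]_N) : open A ->
  smooth_on A h -> smooth_on A F -> smooth_on A (fun x => 'd h x (F x)).
Proof.
move=> oA sh sF k.
apply: cdiff_on_mx => // i j; rewrite (ord1 i) {i}.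
apply: (cdiff_on_ext (f := fun x =>
    \sum_l F x 0 l * 'D_(delta_mx 0 l) h x 0 j)) => //.
  move=> x Ax; have [dh _] := sh 1.
  rewrite [X in 'd h x X](row_sum_delta (F x)) linear_sum summxE.
  apply: eq_bigr => l _; rewrite linearZ /= mxE deriveE //.
  exact: dh.
apply: cdiff_on_sum => // l; apply: cdiff_onM => //; apply: cdiff_on_coord => //.
exact: smooth_on_derive.
Qed.

(** Bootstrapping: differentiating [h] along a solution gives the derivative
    of [h] in the direction of the field, which is again a smooth function along
    the solution. Induction over all [h] at once therefore yields every order of
    differentiability. *)
Lemma smooth_along_flow N m (A : set 'rV[R]_N) (F : 'rV[R]_N -> 'rV[R]_N)
    (h : 'rV[R]_N -> 'rV[R]_m) (I : set R) (y : R -> 'rV[R]_N) :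
  open A -> open (I `&` y @^-1` A) -> smooth_on A F -> smooth_on A h ->
  (forall t : R, I t -> is_derive t 1 y (F (y t))) ->
  smooth_on (I `&` y @^-1` A) (h \o y).
Proof.
move=> oA oI sF sh dy k.
have dhy (g : 'rV[R]_N -> 'rV[R]_m) (t : R) : smooth_on A g ->
    (I `&` y @^-1` A) t -> is_derive t 1 (g \o y) ('d g (y t) (F (y t))).
  move=> sg [It At]; apply: is_derive_comp; last exact: dy.
  by have [dg _] := sg 1; exact: dg.
elim: k h sh => [|k IH] h sh /=.
  by move=> t It; exact: is_derive_continuous (dhy _ _ sh It).
have dfh (t : R) : (I `&` y @^-1` A) t -> differentiable (h \o y) t.
  by move=> It; have [/derivable1_diffP] := dhy _ _ sh It.
split=> // v.
apply: (cdiff_on_ext (f := (fun x => 'd h x (v *: F x)) \o y)) => //.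
  move=> t It; have [_ dE] := dhy _ _ sh It.
  rewrite /= linearZ -dE [RHS]deriveE; last exact: dfh.
  by rewrite -[in RHS](mulr1 v) [RHS]linearZ deriveE //; exact: dfh.
apply: IH => l; apply: smooth_on_diff => // k'.
apply: cdiff_on_mx => // i j.
apply: (cdiff_on_ext (f := fun x => v * F x i j)) => //.
  by move=> x _; rewrite mxE.
by apply: cdiff_onM => //; [exact: cdiff_on_cst|exact: cdiff_on_coord].
Qed.

End Flow.

(** * Integral curves on a manifold *)

Section Mfd.
Context {R : realType} {N : nat} {M : manifold R N}.
Implicit Types (i j : chart M) (U Z : set M) (X : vfield M) (c : R -> M).

Lemma open_coord U i : open U -> open (coord i @` (U `&` dom i)).
Proof. by move=> oU; exact: oU. Qed.

(** The domain condition also transfers, because a curve with a derivative is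
    continuous and the chart overlap is open. *)
Lemma velocity_chart_change i j c (t : R) a : dom i (c t) -> dom j (c t) ->
  (\forall s \near t, dom i (c s)) -> is_derive t 1 (coord i \o c) a ->
  (\forall s \near t, dom j (c s)) /\
  is_derive t 1 (coord j \o c) ('d (coord j \o param i) (coord i (c t)) a).
Proof.
move=> ict jct nic dc.
have no : \forall s \near t, (coord i @` (dom i `&` dom j)) (coord i (c s)).
  have cc : {for t, continuous (coord i \o c)} by exact: is_derive_continuous dc.
  apply: cc; apply: open_nbhs_nbhs; split; first exact: open_overlap.
  by exists (c t).
have njc : \forall s \near t, dom j (c s).
  apply: filterS2 nic no => s ics [q [iq jq] qc].
  by rewrite -(coordK ics) -qc coordK.
split=> //.
apply: (near_eq_is_derive (f := (coord j \o param i) \o (coord i \o c))).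
  by apply: filterS nic => s ics /=; rewrite coordK.
apply: is_derive_comp => //; exact: transition_diff.
Qed.

(** Velocities are defined through the preferred chart at the point, which
    varies along the curve; this lets a whole piece of curve be studied in one
    fixed chart. *)
Lemma has_velocityP i c (t : R) (w : tangent (c t)) : dom i (c t) ->
  has_velocity c t (c t) w <->
  (\forall s \near t, dom i (c s)) /\
  is_derive t 1 (coord i \o c) (tangent_coord i (c t) w).
Proof.
move=> ic; have cc := dom_chart_at (c t); split=> [[_ nc dc]|[nc dc]].
  exact: velocity_chart_change nc dc.
have [nc' dc'] := velocity_chart_change ic cc nc dc.
by split=> //; move: dc'; rewrite -/(tangent_vec i (c t) _) tangent_coordK.
Qed.

Lemma mdiff_chart (f : M -> R) i p (w : tangent p) :
  smooth_fun setT f -> dom i p ->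
  mdiff f p w = 'd (f \o param i) (coord i p) (tangent_coord i p w).
Proof.
move=> sf ip; have cp := dom_chart_at p.
have df j : dom j p -> differentiable (f \o param j) (coord j p).
  by move=> jp; have [+ _] := sf j 1; apply; exists p.
rewrite /mdiff /tangent_coord; apply/esym/diff_comp_at; last 1 first.
- exact: df.
- by rewrite /= coordK.
- have : nbhs (coord (chart_at p) p)
      (coord (chart_at p) @` (dom (chart_at p) `&` dom i)).
    by apply: open_nbhs_nbhs; split; [exact: open_overlap|exists p].
  by apply: filterS => _ [q [jq iq] <-] /=; rewrite !coordK.
- exact: transition_diff.
Qed.

Lemma is_derive_along (f : M -> R) c (t : R) (w : tangent (c t)) :
  smooth_fun setT f -> has_velocity c t (c t) w ->
  is_derive t 1 (f \o c) (mdiff f (c t) w).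
Proof.
move=> sf [_ nc dc].
apply: (near_eq_is_derive
    (f := (f \o param (chart_at (c t))) \o (coord (chart_at (c t)) \o c))).
  by apply: filterS nc => s ics /=; rewrite coordK.
apply: is_derive_comp => //.
have [+ _] := sf (chart_at (c t)) 1; apply; exists (c t) => //; split=> //.
exact: dom_chart_at.
Qed.

Definition smooth_vfield_on U X : Prop := forall i,
  smooth_on (coord i @` (U `&` dom i))
    (fun x => tangent_coord i (param i x) (X (param i x))).

(** Solve the differential equation in the preferred chart at [p] and transport
    the solution back with the parametrisation. *)
Lemma exists_integral_curve U X p : open U -> smooth_vfield_on U X -> U p ->
  exists e c, [/\ 0 < e, smooth_curve `]- e, e[ c, c 0 = p &
    integral_curve X U (- e) e c].
Proof.
move=> oU sX Up; pose i := chart_at p; have ip : dom i p by exact: dom_chart_at.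
pose A := coord i @` (U `&` dom i).
pose F x := tangent_coord i (param i x) (X (param i x)).
have oA : open A by exact: open_coord.
have Ap : A (coord i p) by exists p.
have sF : smooth_on A F by exact: sX.
have [e [y [e0 y0 yP]]] := local_solution oA Ap (sF 1).
pose I : set R := `]- e, e[%classic.
have Ic t : I t -> `|t| < e by rewrite /I /= in_itv /= -ltr_norml.
have cy : {in I, continuous y}.
  by move=> t; rewrite inE => /Ic /yP[_ /is_derive_continuous].
pose c := param i \o y.
have ciy t : A (y t) -> dom i (c t) /\ U (c t).
  by move=> [q [Uq iq] qy]; rewrite /c /= -qy coordK.
have ciyE t : A (y t) -> coord i (c t) = y t.
  by move=> [q [_ iq] qy]; rewrite /c /= -qy coordK.
have nI t : I t -> \forall s \near t, `|s| < e.
  move=> /Ic te; exact: (@cvgr_lt _ _ _ _ _ _ (norm_continuous (x := t))).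
exists e, c; split=> //; rewrite -/I.
- move=> j; pose A' := coord i @` (U `&` dom i `&` dom j).
  have oA' : open A'.
    rewrite /A' -setIA (_ : U `&` _ = (U `&` dom i) `&` (dom i `&` dom j)).
      rewrite (_ : _ @` _ = A `&` (coord i @` (dom i `&` dom j))).
        by apply: openI => //; exact: open_overlap.
      apply/seteqP; split=> [_ [q [[Uq iq] [_ jq]] <-]|x].
        by split; exists q.
      move=> [[q [Uq iq] <-] [q' [iq' jq'] qq']]; exists q => //.
      by split=> //; split=> //; rewrite -(coordK iq) -qq' coordK.
    apply/seteqP; split=> q; first by move=> [Uq [iq jq]].
    by move=> [[Uq iq] [_ jq]].
  have AA' : A' `<=` A by move=> _ [q [[Uq iq] jq] <-]; exists q.
  have IE : I `&` c @^-1` dom j = I `&` y @^-1` A'.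
    apply/seteqP; split=> t [It H]; split=> //=; last first.
      by case: H => q [[Uq iq] jq] qy; rewrite /c /= -qy coordK.
    have [Ay _] := yP _ (Ic _ It); have [ic Uc] := ciy _ Ay.
    by rewrite -(ciyE _ Ay); exists (c t).
  have oI : open (I `&` y @^-1` A').
    rewrite openE => t [It At]; apply: filterI.
      by apply: open_nbhs_nbhs; split=> //; exact: itv_open.
    by apply: cy; [rewrite inE|apply: open_nbhs_nbhs].
  split; first by rewrite IE.
  rewrite IE.
  have sA' : smooth_on A' (coord j \o param i).
    move=> k; apply: cdiff_onS (smooth_transition i j k).
    by move=> _ [q [[_ iq] jq] <-]; exists q.
  apply: (smooth_along_flow (F := F) oA' oI _ sA').
    by move=> k; exact: cdiff_onS AA' (sF k).
  by move=> t /Ic /yP[].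
- by rewrite /c /= y0 coordK.
- move=> t te; have It : I t by rewrite /I /= in_itv.
  have [Ay dy] := yP _ (Ic _ It); have [ic Uc] := ciy _ Ay.
  split=> //; apply/(has_velocityP _ ic); split.
    by apply: filterS (nI _ It) => s /yP[/ciy[]].
  apply: (near_eq_is_derive (f := y)).
    by apply: filterS (nI _ It) => s /yP[/ciyE].
Qed.

(** A curve in [Z] annihilates [f], hence so does its velocity. *)
Lemma tangent_sub_mdiff Z p (w : tangent p) (f : M -> R) : smooth_fun setT f ->
  (forall q, Z q -> f q = 0) -> tangent_sub Z p w -> mdiff f p w = 0.
Proof.
move=> sf Zf [e [c [e0 _ Zc cw]]].
have c0 : c 0 = p by case: cw.
move: w cw; rewrite -c0 => w cw.
have [_ <-] := is_derive_along sf cw.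
rewrite (near_eq_derive (g := cst 0)) ?derive_cst //.
have : \forall t \near (0 : R), `|t| < e.
  apply: (@cvgr_lt _ _ _ _ _ _ (norm_continuous (x := (0 : R)))).
  by rewrite normr0.
by apply: filterS => t; rewrite ltr_norml => te /=; apply: Zf; exact: Zc.
Qed.

End Mfd.

(** * Invariance of the zero set of a submersion *)

Section Inv.
Context {R : realType} {N m : nat} {M : manifold R N}.
Variable phi : 'I_m -> M -> R.
Hypothesis sphi : forall a, smooth_fun setT (phi a).
Let Z : set M := [set p | forall a, phi a p = 0].
Hypothesis subm : forall p, Z p -> forall y : 'I_m -> R,
  exists w : tangent p, forall a, mdiff (phi a) p w = y a.

Lemma near_oo (a b t : R) : a < t < b -> \forall s \near t, a < s < b.
Proof.
move=> tab; have : t \in `]a, b[ by rewrite in_itv.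
by move=> /near_in_itvoo; apply: filterS => s; rewrite in_itv.
Qed.

(** In a chart, let [f] be the defining map and [P] its derivative along [X].
    Then [P] is locally Lipschitz and vanishes wherever [f] does, while the
    distance to the zero set of [f] is at most a multiple of [`|f|]; so [`|P|] is
    itself at most a multiple of [`|f|]. Along the curve this is the hypothesis
    of Gronwall's lemma. *)
Lemma zero_set_invariant_near U (X : vfield M) a b c (t0 : R) :
  open U -> smooth_vfield_on U X ->
  (forall p, U p -> Z p -> forall k, mdiff (phi k) p (X p) = 0) ->
  integral_curve X U a b c -> a < t0 < b -> Z (c t0) ->
  \forall t \near t0, Z (c t).
Proof.
move=> oU sX tang ic t0I Zc0.
pose p := c t0; pose i := chart_at p; pose x0 := coord i p.
have ip : dom i p by exact: dom_chart_at.
pose A := coord i @` (U `&` dom i).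
pose F x := tangent_coord i (param i x) (X (param i x)).
pose f (x : 'rV[R]_N) : 'rV[R]_m := \row_k (phi k \o param i) x.
pose P x := 'd f x (F x).
have [Up _] := ic _ t0I.
have oA : open A by exact: open_coord.
have Ax0 : A x0 by exists p.
have sphiA k : smooth_on A (phi k \o param i).
  move=> l; apply: cdiff_onS (sphi k i l).
  by move=> _ [q [_ iq] <-]; exists q.
have sf : smooth_on A f.
  move=> l; apply: cdiff_on_mx => // r k.
  apply: (cdiff_on_ext (f := phi k \o param i)) => //; last exact: sphiA.
  by move=> x _; rewrite mxE.
have sF : smooth_on A F by exact: sX.
have [df _] := sf 1.
have dfE x w k : A x -> ('d f x w) 0 k = 'd (phi k \o param i) x w.
  move=> Ax; rewrite -deriveE; last exact: df.
  have [dphi _] := sphiA k 1.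
  rewrite (derive_mx (diff_derivable (df _ Ax))) mxE -deriveE; last exact: dphi.
  by congr ('D_w _ x); apply/funext => z; rewrite mxE.
have fZ q : dom i q -> f (coord i q) = 0 -> Z q.
  by move=> iq /rowP fq k; have := fq k; rewrite !mxE /= coordK.
have Zf q : dom i q -> Z q -> f (coord i q) = 0.
  by move=> iq Zq; apply/rowP => k; rewrite !mxE /= coordK // Zq.
have FX q : dom i q -> F (coord i q) = tangent_coord i q (X q).
  by move=> iq; rewrite /F coordK.
have PZ x : A x -> f x = 0 -> P x = 0.
  move=> Ax; have [q [Uq iq] <-] := Ax => fq; apply/rowP => k; rewrite mxE.
  rewrite /P dfE; last by exists q.
  by rewrite FX // -mdiff_chart // tang //; exact: fZ.
have surj (y : 'rV[R]_m) : exists w, 'd f x0 w = y.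
  have [w wy] := subm Zc0 (fun k => y 0 k).
  by exists w; apply/rowP => k; rewrite dfE // -wy.
have sP : smooth_on A P by exact: smooth_on_diff.
have [K [r [K0 r0 rA PK]]] := cdiff1_lipschitz_near oA Ax0 (sP 1).
have [C C0 nC] :=
  submersion_metric_regularity oA Ax0 (sf 1) (Zf _ ip Zc0) surj r0.
have Ple : \forall x \near x0, `|P x| <= (K * C) * `|f x|.
  have nr : \forall x \near x0, ball x0 r x by exact: nbhsx_ballx.
  apply: filterS2 nC nr => x [z [zr Az fz xz]] xr.
  rewrite -[P x]subr0 -(PZ z) // (le_trans (PK _ _ xr zr)) // -mulrA.
  exact: ler_wpM2l.
have nI : \forall t \near t0, a < t < b.
  exact: near_oo.
have [_ vc0] := ic _ t0I.
have [nic dc0] := (has_velocityP _ ip).1 vc0.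
have cc : {for t0, continuous (coord i \o c)} by exact: is_derive_continuous dc0.
have nP : \forall t \near t0,
    `|P (coord i (c t))| <= (K * C) * `|f (coord i (c t))|.
  exact: cc Ple.
have : \forall t \near t0, f (coord i (c t)) = 0.
  apply: (@gronwall_near R m _ (fun t => P (coord i (c t))) (K * C)).
    exact: Zf.
  apply: filterS3 nic nI nP => t ict tI Pt.
  split=> //; have [Uct vct] := ic _ tI.
  have [_ dct] := (has_velocityP _ ict).1 vct.
  rewrite /P FX //; apply: (is_derive_comp (c := coord i \o c)) => //.
  by apply: df; exists (c t).
apply: filterS2 nic => t ict; exact: fZ.
Qed.

(** The times spent in [Z] form a closed subset of the interval by continuity
    and an open one by [zero_set_invariant_near]. *)
Lemma zero_set_invariant U (X : vfield M) a b c :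
  open U -> smooth_vfield_on U X ->
  (forall p, U p -> Z p -> forall k, mdiff (phi k) p (X p) = 0) ->
  integral_curve X U a b c -> a < 0 < b -> Z (c 0) ->
  forall t, a < t < b -> Z (c t).
Proof.
move=> oU sX tang ic ab0 Zc0 t tab.
have cI : connected (`]a, b[%classic : set R).
  by apply/connected_intervalP; exact: interval_is_interval.
pose B : set R := [set s | a < s < b /\ Z (c s)].
suff : B = `]a, b[%classic.
  by move/seteqP => [_ /(_ t)] /=; rewrite in_itv => /(_ tab) [].
apply: cI; first by exists 0.
- exists B; last first.
    apply/seteqP; split=> s; last by case.
    by move=> Bs; split=> //=; rewrite in_itv; exact: Bs.1.
  rewrite openE => s [sI Zs]; apply: filterI; first exact: near_oo.
  exact: (zero_set_invariant_near oU sX tang ic sI Zs).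
- exists (closure B); first exact: closed_closure.
  apply/seteqP; split=> s.
    move=> Bs; split; last exact: subset_closure.
    by rewrite /= in_itv; exact: Bs.1.
  rewrite /= in_itv => -[sI cB]; split=> // k.
  have [_ vs] := ic _ sI.
  have cs : {for s, continuous (phi k \o c)}.
    exact: is_derive_continuous (is_derive_along (sphi k) vs).
  apply/eqP; apply: contrapT => /negP ps.
  have : \forall r \near s, phi k (c r) != 0.
    exact: (cvgr_neq0 (phi k (c s)) cs ps).
  by move=> /cB [r [[_ Zr]]]; rewrite Zr eqxx.
Qed.

End Inv.

(** * Vertical vectors of the tangent bundle *)

Section Vert.
Context {R : realType} {n : nat} {Q : manifold R n}.
Local Notation TQ := (tbundle Q).
Implicit Types i j : chart Q.

(** Computes a directional derivative from the values on one line only. It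
    serves for vertical derivatives of functions that are polynomial along the
    fibres of the tangent bundle. *)
Lemma derive_quadratic_line (V W : normedModType R) (f : V -> W) z v w w' :
  (forall h : R, f (h *: v + z) = f z + h *: w + h ^+ 2 *: w') -> 'D_v f z = w.
Proof.
move=> fE; apply/cvg_lim => //.
have H : (w + h *: w') @[h --> (0 : R)^'] --> w.
  have -> : nbhs w = nbhs (w + (0 : R) *: w') by rewrite scale0r addr0.
  apply: cvgD; first exact: cvg_cst.
  by apply: cvgZr_tmp; exact: cvg_within.
apply: cvg_trans H; apply: near_eq_cvg; near=> h.
have h0 : h != 0 by near: h; exact: nbhs_dnbhs_neq.
rewrite /= fE -[f z + _ + _]addrA [f z + _]addrC addrK scalerDr !scalerA.
by rewrite expr2 mulrA mulVf // scale1r mul1r.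
Unshelve. all: by end_near. Qed.

Lemma tangent_vec_self (q : Q) (v : tangent q) :
  tangent_vec (chart_at q) q v = v.
Proof. by rewrite /tangent_vec transition_self //; exact: dom_chart_at. Qed.

Lemma tbundle_nbhs i j (z : 'rV[R]_(n + n)) :
  (coord i @` (dom i `&` dom j)) (lsubmx z) ->
  \forall z' \near z, (coord i @` (dom i `&` dom j)) (lsubmx z').
Proof.
move=> Az; apply: (continuous_lsubmx (x := z)).
by apply: open_nbhs_nbhs; split=> //; exact: open_overlap.
Qed.

Lemma diff_lsubmx (z w : 'rV[R]_(n + n)) : 'd lsubmx z w = lsubmx w :> 'rV[R]_n.
Proof.
rewrite (@diff_lin R _ _ (lsubmx : {linear 'rV[R]_(n + n) -> 'rV[R]_n})) //.
by move=> ?; exact: continuous_lsubmx.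
Qed.

Lemma tbundle_transition_diff i j (z : 'rV[R]_(n + n)) :
  (coord i @` (dom i `&` dom j)) (lsubmx z) ->
  differentiable (tbundle_coord j \o tbundle_param i) z.
Proof.
move=> Az; have [+ _] := tbundle_smooth_transition (Q := Q) i j 1; apply.
by rewrite tbundle_overlap.
Qed.

(** Transition maps of the tangent bundle are linear on fibres. *)
Lemma diff_tbundle_transition_vertical i j (z : 'rV[R]_(n + n)) (b : 'rV[R]_n) :
  (coord i @` (dom i `&` dom j)) (lsubmx z) ->
  'd (tbundle_coord j \o tbundle_param i) z (row_mx 0 b) =
  row_mx 0 ('d (coord j \o param i) (lsubmx z) b).
Proof.
move=> Az; rewrite -deriveE; last exact: tbundle_transition_diff.
have [q [iq jq] qz] := Az.
have dij : differentiable (coord j \o param i) (lsubmx z).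
  by rewrite -qz; exact: transition_diff.
apply: (@derive_quadratic_line _ _ _ _ _ _ 0) => h.
have lE : lsubmx (h *: row_mx (0 : 'rV_n) b + z) = lsubmx z.
  by rewrite linearD linearZ /= row_mxKl scaler0 add0r.
rewrite !tbundle_transition ?lE // scaler0 addr0.
rewrite [h *: row_mx _ ('d _ _ _)]scale_row_mx.
rewrite add_row_mx scaler0 addr0; congr row_mx.
rewrite linearD linearZ /= row_mxKr.
rewrite [X in 'd _ _ X](row_sum_delta b) linear_sum scaler_sumr -big_split.
apply: eq_bigr => k _ /=.
by rewrite linearZ /= -deriveE // !mxE scalerDl addrC scalerA.
Qed.

(** Transition maps of the tangent bundle cover those of the base. Together with
    [diff_tbundle_transition_vertical] this says that the almost tangent
    structure does not depend on the chart. *)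
Lemma diff_tbundle_transition_base i j (z w : 'rV[R]_(n + n)) :
  (coord i @` (dom i `&` dom j)) (lsubmx z) ->
  lsubmx ('d (tbundle_coord j \o tbundle_param i) z w) =
  'd (coord j \o param i) (lsubmx z) (lsubmx w).
Proof.
move=> Az; have [q [iq jq] qz] := Az.
have dT := tbundle_transition_diff Az.
have dij : differentiable (coord j \o param i) (lsubmx z).
  by rewrite -qz; exact: transition_diff.
rewrite -(diff_lsubmx ((tbundle_coord j \o tbundle_param i) z) ('d _ _ w)).
rewrite -(diff_lsubmx z w).
pose h (z' : 'rV[R]_(n + n)) := (coord j \o param i) (lsubmx z').
transitivity ('d h z w).
  apply: diff_comp_at => //; last exact: differentiable_lsubmx.
  apply: filterS (tbundle_nbhs Az) => z' Az'.
  by rewrite /h tbundle_transition // row_mxKl.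
apply/esym; apply: diff_comp_at => //; last exact: differentiable_lsubmx.
by near=> z'.
Unshelve. all: by end_near. Qed.

Lemma tangent_coord_vertical i (p : TQ) (b : tangent (tbase p)) :
  dom i (tbase p) ->
  tangent_coord (M := TQ) i p (row_mx 0 b) =
  row_mx 0 (tangent_coord i (tbase p) b).
Proof.
move=> ip; have cp := dom_chart_at (tbase p).
rewrite /tangent_coord; transitivity ('d (tbundle_coord i \o
  tbundle_param (chart_at (tbase p))) (tbundle_coord (chart_at (tbase p)) p)
    (row_mx 0 b)) => //.
rewrite diff_tbundle_transition_vertical row_mxKl //.
by exists (tbase p).
Qed.

Lemma tangent_vec_base i (p : TQ) (w : 'rV[R]_(n + n)) : dom i (tbase p) ->
  lsubmx (tangent_vec (M := TQ) i p w) =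
  tangent_vec i (tbase p) (lsubmx w) :> 'rV[R]_n.
Proof.
move=> ip; have cp := dom_chart_at (tbase p).
rewrite /tangent_vec; transitivity (lsubmx ('d
  (tbundle_coord (chart_at (tbase p)) \o tbundle_param i)
  (tbundle_coord i p) w) : 'rV[R]_n) => //.
rewrite diff_tbundle_transition_base row_mxKl //.
by exists (tbase p).
Qed.

Lemma vlift1E (alpha : tensor1 Q) (p : TQ) (w : tangent p) :
  vlift1 alpha p w = alpha (tbase p) (lsubmx w).
Proof.
rewrite /vlift1 /tangent_map /tau_proj; congr (alpha _ _).
have cp := dom_chart_at (tbase p).
set i := chart_at (tbase p).
transitivity ('d (coord i \o tbase (Q := Q) \o tbundle_param i)
  (tbundle_coord i p) w) => //.
have E : \forall z \near tbundle_coord i p,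
    lsubmx z = (coord i \o tbase (Q := Q) \o tbundle_param i) z.
  have Az : (coord i @` (dom i `&` dom i)) (lsubmx (tbundle_coord i p)).
    by rewrite row_mxKl; exists (tbase p).
  by apply: filterS (tbundle_nbhs Az) => z [q [iq _] qz] /=; rewrite -qz coordK.
have [|_ ->] := diff_near_eq E; first exact: differentiable_lsubmx.
exact: diff_lsubmx.
Qed.

End Vert.

(** * The Lagrangian two-form on vertical vectors *)

Section Scalar.
Context {R : realType}.

Lemma scalar_comb (V : lmodType R) (f : V -> R) (I : Type) (r : seq I)
    (c : I -> R) (v : I -> V) : scalar f ->
  f (\sum_(i <- r) c i *: v i) = \sum_(i <- r) c i * f (v i).
Proof.
move=> sf; elim: r => [|i r IH]; last by rewrite !big_cons sf IH.
by rewrite !big_nil; have := sf (-1) 0 0; rewrite scaler0 addr0 mulN1r addNr.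
Qed.

Lemma scalarZ (V : lmodType R) (f : V -> R) (a : R) v : scalar f ->
  f (a *: v) = a * f v.
Proof.
move=> sf; have := scalar_comb [:: tt] (fun=> a) (fun=> v) sf.
by rewrite !big_seq1.
Qed.
Lemma scalar0 (V : lmodType R) (f : V -> R) : scalar f -> f 0 = 0.
Proof. by move=> /(scalarZ 0 0); rewrite scale0r mul0r. Qed.
End Scalar.

Section Lag.
Context {R : realType} {n : nat} {Q : manifold R n}.
Local Notation TQ := (tbundle Q).
Implicit Types i j : chart Q.
Variables (g : tensor2 Q) (gm : riemannian_metric g).
Arguments g : clear implicits.

Let g_scalar (p : Q) (u : tangent p) : scalar (g p u).
Proof. by have [gs _ _ _] := gm; exact: gs. Qed.

Let gC (p : Q) (u v : tangent p) : g p u v = g p v u.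
Proof. by have [_ gs _ _] := gm; exact: gs. Qed.

Let g_scalarl (p : Q) (u : tangent p) : scalar (fun v => g p v u).
Proof. by move=> a v w; rewrite ![g p _ u]gC g_scalar. Qed.

Definition metric_in i (x a b : 'rV[R]_n) : R :=
  g (param i x) (tangent_vec i (param i x) a) (tangent_vec i (param i x) b).

Lemma metric_in_coord i (q : Q) a b : dom i q ->
  metric_in i (coord i q) a b = g q (tangent_vec i q a) (tangent_vec i q b).
Proof. by move=> iq; rewrite /metric_in coordK. Qed.

Lemma metric_inC i x a b : metric_in i x a b = metric_in i x b a.
Proof. exact: gC. Qed.

Lemma metric_in_scalar i x a : scalar (metric_in i x a).
Proof.
move=> k b c; rewrite /metric_in -g_scalar; congr (g _ _ _).
by rewrite /tangent_vec linearP.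
Qed.

Lemma metric_in_scalarl i x b : scalar (metric_in i x ^~ b).
Proof.
move=> k a c; rewrite !(metric_inC _ _ _ b); exact: metric_in_scalar.
Qed.

Lemma metric_inE i x a b :
  metric_in i x a b = \sum_j \sum_k a 0 j * b 0 k * coef2 i g j k x.
Proof.
rewrite {1}[a]row_sum_delta (scalar_comb _ _ _ (metric_in_scalarl i x b)).
apply: eq_bigr => j _.
rewrite {1}[b]row_sum_delta (scalar_comb _ _ _ (metric_in_scalar i x _)) mulr_sumr.
by apply: eq_bigr => k _; rewrite mulrA.
Qed.

Section Lagrangian.
Variables (V : Q -> R) (sV : smooth_fun setT V).
Let L := mech_lagrangian g V.

Lemma mech_lagrangian_param i (z : 'rV[R]_(n + n)) :
  L (tbundle_param i z) =
  2^-1 * metric_in i (lsubmx z) (rsubmx z) (rsubmx z) - V (param i (lsubmx z)).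
Proof. by []. Qed.

Lemma mech_lagrangian_smooth : smooth_fun setT L.
Proof.
suff H i : smooth_on (tbundle_coord i @` (setT `&` tbundle_dom i))
    (L \o tbundle_param i) by exact: H.
move=> k; rewrite setTI.
pose A : set 'rV[R]_n := coord i @` dom i.
pose TA : set 'rV[R]_(n + n) := lsubmx @^-1` A.
have -> : tbundle_coord i @` tbundle_dom i = TA.
  by have := tbundle_overlap i i; rewrite !setIid.
have oA : open A by rewrite /A -[dom _]setIid; exact: open_overlap.
have cl : continuous (lsubmx : 'rV[R]_(n + n) -> 'rV[R]_n).
  exact: continuous_lsubmx.
have cr : continuous (rsubmx : 'rV[R]_(n + n) -> 'rV[R]_n).
  exact: continuous_rsubmx.
have oTA : open TA by apply: open_comp => // z _; exact: cl.
have lP (f : 'rV[R]_n -> R) : smooth_on A f ->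
    cdiff_on k TA (fun z : 'rV[R]_(n + n) => f (lsubmx z)).
  by move=> sf; exact: (cdiff_on_precomp (L := lsubmx) cl oA (sf k)).
have rP l : cdiff_on k TA (fun z : 'rV[R]_(n + n) => rsubmx z 0 l).
  apply: cdiff_on_coord => //.
  have := cdiff_on_precomp (L := rsubmx) cr openT (cdiff_on_id k setT).
  by apply: cdiff_onS.
apply: (cdiff_on_ext (f := fun z : 'rV[R]_(n + n) =>
    2^-1 * (\sum_j \sum_l rsubmx z 0 j * rsubmx z 0 l *
    coef2 i g j l (lsubmx z)) + (-1) * V (param i (lsubmx z))) oTA).
  by move=> z _; rewrite /= mech_lagrangian_param metric_inE mulN1r.
apply: cdiff_onD => //; apply: cdiff_onM => //; try exact: cdiff_on_cst.
  do 2!apply: cdiff_on_sum => // ?; apply: cdiff_onM => //; first exact: cdiff_onM.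
  by apply: lP; have [_ _ _ sg] := gm; exact: sg.
by apply: (lP (V \o param i)); have := sV i; rewrite setTI.
Qed.

(** The Legendre transformation of a mechanical Lagrangian is the metric: the
    potential is constant on fibres and the kinetic energy quadratic there. *)
Lemma mdiff_lagrangian_vertical (p : TQ) (w : 'rV[R]_n) :
  mdiff L p (row_mx 0 w) = g (tbase p) (tvel p) w.
Proof.
have cp := dom_chart_at (tbase p); pose c := chart_at (tbase p).
transitivity ('d (L \o tbundle_param c) (tbundle_coord c p) (row_mx 0 w)) => //.
rewrite -deriveE; last first.
  have [+ _] := mech_lagrangian_smooth c 1; rewrite setTI; apply.
  by exists p.
have -> : g (tbase p) (tvel p) w =
    metric_in c (coord c (tbase p)) (tangent_coord c (tbase p) (tvel p)) w.
  by rewrite metric_in_coord // tangent_coordK // tangent_vec_self.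
apply: (@derive_quadratic_line _ _ _ _ _ _ _
  (2^-1 * metric_in c (coord c (tbase p)) w w)) => h.
rewrite /= !mech_lagrangian_param linearD linearZ /= row_mxKl scaler0 add0r.
rewrite linearD linearZ /= row_mxKr /tbundle_coord row_mxKl row_mxKr.
set x := coord c _; set y := tangent_coord _ _ _.
have -> : metric_in c x (h *: w + y) (h *: w + y) =
    h * (h * metric_in c x w w + metric_in c x w y) +
    (h * metric_in c x w y + metric_in c x y y).
  rewrite metric_in_scalar (metric_inC c x _ w) (metric_inC c x _ y).
  by rewrite !metric_in_scalar (metric_inC c x y w).
by rewrite (metric_inC c x y w) -![_ *: _]/(_ * _); field.
Qed.

(** A chart-free expression of the one-form [J^* dL], which allows its
    coefficients to be computed in a chart that is not the preferred one. *)
Lemma cartan_formE (p : TQ) (w : tangent p) :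
  almost_tangent_dual (mdiff L) p w = g (tbase p) (tvel p) (lsubmx w).
Proof. exact: mdiff_lagrangian_vertical. Qed.

Lemma coef1_cartan_base i (d : 'I_n) (z : 'rV[R]_(n + n)) :
  (coord i @` dom i) (lsubmx z) ->
  coef1 (M := TQ) i (almost_tangent_dual (mdiff L)) (lshift n d) z =
  metric_in i (lsubmx z) (rsubmx z) (delta_mx 0 d).
Proof.
move=> [q iq qz]; rewrite /coef1 cartan_formE /coord_vec.
rewrite (@tangent_vec_base _ _ _ i (tbundle_param i z)); last first.
  by rewrite /= -qz coordK.
by rewrite delta_mx_lshift row_mxKl.
Qed.

Lemma coef1_cartan_fibre i (d : 'I_n) (z : 'rV[R]_(n + n)) :
  (coord i @` dom i) (lsubmx z) ->
  coef1 (M := TQ) i (almost_tangent_dual (mdiff L)) (rshift n d) z = 0.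
Proof.
move=> [q iq qz]; rewrite /coef1 cartan_formE /coord_vec.
rewrite (@tangent_vec_base _ _ _ i (tbundle_param i z)); last first.
  by rewrite /= -qz coordK.
rewrite delta_mx_rshift row_mxKl /tangent_vec linear0.
exact: (scalar0 (@g_scalar _ _)).
Qed.

(** In coordinates [J^* dL] is [g_dl qdot^l dq^d]. Only base components are
    nonzero, so contracting its exterior derivative with a vertical vector leaves
    the vertical derivative of these components, which is the metric. With [b] a
    value of [Y a] the result is minus the vertical lift of [f a], which is why
    feedback perturbs [i_G omega = dE] exactly inside the span of these lifts. *)
Lemma omega_vertical (p : TQ) (b : 'rV[R]_n) (w : tangent p) :
  omega_of L p (row_mx 0 b) w = - g (tbase p) b (lsubmx w).
Proof.
congr (- _); rewrite /ext_deriv.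
have cq := dom_chart_at (tbase p); pose c := chart_at (tbase p).
set x := coord (m := TQ) _ p.
have xE : x = row_mx (coord c (tbase p))
  (tangent_coord c (tbase p) (tvel p)) by [].
have cx : (coord c @` dom c) (lsubmx x).
  by exists (tbase p); rewrite // xE row_mxKl.
have D0 v d : 'D_v (coef1 (M := TQ) (chart_at p) (almost_tangent_dual (mdiff L))
    (rshift n d)) x = 0.
  rewrite (near_eq_derive (g := cst 0)) ?derive_cst //.
  have cx' : (coord c @` (dom c `&` dom c)) (lsubmx x) by rewrite setIid.
  apply: filterS (tbundle_nbhs cx') => z; rewrite setIid => cz.
  exact: coef1_cartan_fibre.
have D1 e d : 'D_(delta_mx 0 (rshift n e)) (coef1 (M := TQ) (chart_at p)
    (almost_tangent_dual (mdiff L)) (lshift n d)) x =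
    metric_in c (lsubmx x) (delta_mx 0 e) (delta_mx 0 d).
  apply: (@derive_quadratic_line _ _ _ _ _ _ _ 0) => h.
  have lE : lsubmx (h *: delta_mx 0 (rshift n e) + x) = lsubmx x.
    by rewrite linearD linearZ /= delta_mx_rshift row_mxKl scaler0 add0r.
  rewrite !coef1_cartan_base ?lE // linearD linearZ /= delta_mx_rshift row_mxKr.
  by rewrite metric_in_scalarl scaler0 addr0 addrC.
rewrite big_split_ord /= big1 ?add0r => [|e _]; last first.
  by rewrite big1 // => k _; rewrite row_mxEl mxE !mul0r.
rewrite -[b]tangent_vec_self -[lsubmx w]tangent_vec_self -metric_in_coord //.
rewrite metric_inE; apply: eq_bigr => e _; rewrite row_mxEr.
rewrite big_split_ord /= [X in _ + X]big1 ?addr0 => [|k _]; last first.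
  by rewrite !D0 subrr mulr0.
apply: eq_bigr => d _; rewrite D0 D1 subr0 xE row_mxKl mxE.
by rewrite tangent_vec_self.
Qed.

End Lagrangian.

(** The velocity-dependent coefficients of the complete lift multiply base
    components only, which a vertical vector lacks. *)
Lemma complete_lift_vertical (p : TQ) (b : 'rV[R]_n) (w : tangent p) :
  complete_lift g p (row_mx 0 b) w = g (tbase p) b (lsubmx w).
Proof.
have cq := dom_chart_at (tbase p).
rewrite -[b in RHS]tangent_vec_self -[lsubmx w]tangent_vec_self.
rewrite -metric_in_coord //.
rewrite metric_inE /complete_lift; apply: eq_bigr => j _; apply: eq_bigr => k _.
rewrite row_mxKl row_mxKr mxE mulr0 mul0r mulr0 mul0r !add0r.
by rewrite -mulrA mulrC.
Qed.

End Lag.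

(** * Closed-loop vector fields *)

Section Loop.
Context {R : realType} {n m : nat} {Q : manifold R n}.
Local Notation TQ := (tbundle Q).

Lemma closed_loop_smooth (U : set TQ) (G : vfield TQ) (Y : 'I_m -> vfield Q)
    (v : 'I_m -> TQ -> R) : open U -> smooth_vfield G ->
  (forall a, smooth_vfield (Y a)) -> (forall a, smooth_fun U (v a)) ->
  smooth_vfield_on U (closed_loop G Y v).
Proof.
move=> oU sG sY sv.
suff H (i : chart Q) : smooth_on (tbundle_coord i @` (U `&` tbundle_dom i))
    (fun x => tangent_coord (M := TQ) i (tbundle_param i x)
      (closed_loop G Y v (tbundle_param i x))) by exact: H.
move=> k.
set A := tbundle_coord i @` _.
have oA : open A by exact: (@open_coord _ _ TQ U i oU).
have AA : A `<=` tbundle_coord i @` tbundle_dom i.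
  by move=> _ [q [_ iq] <-]; exists q.
pose B : set 'rV[R]_n := coord i @` dom i.
have oB : open B by rewrite /B -[dom i]setIid; exact: open_overlap.
have AB : A `<=` lsubmx @^-1` B.
  by move=> _ [q [_ iq] <-]; exists (tbase q); rewrite // row_mxKl.
have cl : continuous (lsubmx : 'rV[R]_(n + n) -> 'rV[R]_n).
  exact: continuous_lsubmx.
pose YT a x : 'rV[R]_n := tangent_coord i (param i x) (Y a (param i x)).
have sYT a : cdiff_on k A (fun x : 'rV[R]_(n + n) => YT a (lsubmx x)).
  apply: cdiff_onS AB _.
  exact: (cdiff_on_precomp (L := lsubmx) cl oB (sY a i k)).
apply: (cdiff_on_ext (f := fun x : 'rV[R]_(n + n) =>
    tangent_coord (M := TQ) i (tbundle_param i x) (G (tbundle_param i x)) +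
    \sum_a (v a \o tbundle_param i) x *: row_mx 0 (YT a (lsubmx x))) oA).
  move=> _ [q [Uq iq] <-].
  set p := tbundle_param i _.
  have pq : p = q by exact: tbundle_coordK.
  have ip : dom i (tbase p) by rewrite pq.
  have E a : row_mx 0 (YT a (lsubmx (tbundle_coord i q))) =
      tangent_coord (M := TQ) i p (vlift (Y a) p).
    by rewrite tangent_coord_vertical.
  under eq_bigr do rewrite E.
  rewrite /closed_loop /tangent_coord linearD linear_sum; congr (_ + _).
  by apply: eq_bigr => a _; rewrite linearZ.
apply: cdiff_onD => //.
  by apply: cdiff_onS AA _; exact: sG.
apply: cdiff_on_sum => // a.
apply: cdiff_on_mx => // r l; rewrite (ord1 r).
apply: (cdiff_on_ext (f := fun x : 'rV[R]_(n + n) => (v a \o tbundle_param i) x *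
    (row_mx 0 (YT a (lsubmx x)) : 'rV[R]_(n + n)) 0 l) oA).
  by move=> x _; rewrite !mxE.
apply: cdiff_onM => //; first exact: (sv a i k).
case: (split_ordP l) => e ->.
  apply: (cdiff_on_ext (f := cst 0)) => //; last exact: cdiff_on_cst.
  by move=> x _; rewrite row_mxEl mxE.
apply: (cdiff_on_ext (f := fun x => YT a (lsubmx x) 0 e)) => //.
  by move=> x _; rewrite row_mxEr.
exact: cdiff_on_coord.
Qed.

Lemma omega_ofDl (L : TQ -> R) p (v1 v2 w : tangent p) :
  omega_of L p (v1 + v2 : 'rV[R]_(n + n)) w =
  omega_of L p v1 w + omega_of L p v2 w.
Proof.
rewrite /omega_of -opprD; congr (- _); rewrite /ext_deriv -big_split.
apply: eq_bigr => j _; rewrite -big_split; apply: eq_bigr => k _ /=.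
by rewrite mxE mulrDl mulrDl.
Qed.

Lemma closed_loop_ext (G : vfield TQ) (Y : 'I_m -> vfield Q)
    (u v : 'I_m -> TQ -> R) p :
  (forall a, v a p = u a p) -> closed_loop G Y v p = closed_loop G Y u p.
Proof.
move=> vu; rewrite /closed_loop; congr (_ + _).
by apply: eq_bigr => a _; rewrite vu.
Qed.

(** Tangency is necessary because an integral curve of the extended field
    through each point of the zero set exists and, by invariance, lies in it;
    it is sufficient by [zero_set_invariant]. *)
Lemma makes_invariantP (G : vfield TQ) (Y : 'I_m -> vfield Q)
    (phi : 'I_m -> TQ -> R) (u : 'I_m -> TQ -> R) :
  smooth_vfield G -> (forall a, smooth_vfield (Y a)) ->
  (forall a, smooth_fun setT (phi a)) -> submersive_along_zero_set phi ->
  control_function (zero_set phi) u ->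
  makes_invariant G Y (zero_set phi) u <->
  forall p, zero_set phi p ->
    tangent_sub (zero_set phi) p (closed_loop G Y u p).
Proof.
move=> sG sY sphi subm uc; split=> [inv p Zp|tang].
  have [U [v sv]] := uc; have [oU SU svU vu] := sv.
  have sX := closed_loop_smooth oU sG sY svU.
  have [e [c [e0 sc c0 ic]]] := exists_integral_curve oU sX (SU _ Zp).
  have e00 : - e < 0 < e by rewrite oppr_lt0 e0.
  exists e, c; split=> //.
    by apply: (inv U v sv (- e) e c) => //; rewrite c0.
  have [_] := ic _ e00.
  by rewrite c0 (@closed_loop_ext G Y u v) // => a; exact: vu.
move=> U v sv a b c ab ic c0; have [oU SU svU vu] := sv.
have sX := closed_loop_smooth oU sG sY svU.
apply: (@zero_set_invariant _ _ _ TQ phi sphi subm U (closed_loop G Y v)) => //.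
move=> p Up Zp k.
rewrite (@closed_loop_ext G Y u v) => [|a']; last exact: vu.
by apply: (tangent_sub_mdiff _ _ (tang _ Zp)) => // q; exact.
Qed.

(** Two tangent vectors that differ by an input direction coincide: this is
    where uniqueness of the invariant feedback comes from. *)
Lemma transversal_diff_eq0 (W : vectType R) (w1 w2 : set W) x y d :
  transversal_subspaces w1 w2 -> w1 x -> w1 y -> w2 d -> x - y = d -> d = 0.
Proof.
move=> [U1 [U2 [-> -> Ufull dimU]]] /= xU yU dU xyd.
have : d \in (U1 :&: U2)%VS by rewrite memv_cap dU -xyd rpredB.
suff -> : (U1 :&: U2)%VS = 0%VS by rewrite memv0 => /eqP.
apply/eqP; rewrite -dimv_eq0 -(eqn_add2l (\dim (U1 + U2))) dimv_sum_cap addn0.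
by rewrite -dimU Ufull.
Qed.

End Loop.

(** * Characterisation of invariance *)

Unset Implicit Arguments.

Theorem theorem2 (R : realType) (n m : nat) (Q : manifold R n)
    (Q_hausdorff : hausdorff_space Q)
    (Q_second_countable : @second_countable Q)
    (g : tensor2 Q) (g_metric : riemannian_metric g)
    (V : Q -> R) (V_smooth : smooth_fun setT V)
    (lt_mn : (m < n)%N)
    (f : 'I_m -> tensor1 Q) (f_form : forall a, one_form (f a))
    (Y : 'I_m -> vfield Q) (Y_smooth : forall a, smooth_vfield (Y a))
    (Y_sharp : forall a q, flat g q (Y a q) = f a q)
    (phi : 'I_m -> tbundle Q -> R) (phi_smooth : forall a, smooth_fun setT (phi a))
    (phi_submersive : submersive_along_zero_set phi)
    (M_transversal : forall p, zero_set phi p ->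
       transversal_subspaces (tangent_sub (zero_set phi) p) (vlift_dist Y p))
    (G : vfield (tbundle Q)) (G_EL : euler_lagrange (mech_lagrangian g V) G)
    (u : 'I_m -> tbundle Q -> R) (u_control : control_function (zero_set phi) u) :
  let M := zero_set phi in
  let L := mech_lagrangian g V in
  let Gamma := closed_loop G Y u in
  let residual p (w : tangent p) :=
    iprod Gamma (omega_of L) p w - mdiff (energy L) p w in
  [/\ forall tau, control_function M tau -> makes_invariant G Y M tau ->
        (makes_invariant G Y M u <->
         forall p, M p ->
           residual p = (fun w => - \sum_(a < m) tau a p * vlift1 (f a) p w) /\
           tangent_sub M p (Gamma p)),
      makes_invariant G Y M u <->
        (forall p, M p ->
           (flat (complete_lift g) p @` vlift_dist Y p) (residual p) /\
           tangent_sub M p (Gamma p)) &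
      forall p, flat (complete_lift g) p @` vlift_dist Y p =
                vlift1_span f p].
Proof.
move=> M L Gamma residual.
have [sG GE] := G_EL.
have g_scalarl q b : scalar (fun a : tangent q => g q a b).
  move=> k a c; have [gs gC _ _] := g_metric.
  by rewrite ![g q _ b]gC; exact: gs.
have gY a q (b : tangent q) : g q (Y a q) b = f a q b.
  by have := congr1 (@^~ b) (Y_sharp a q).
have vspan (c : 'I_m -> R) (p : tbundle Q) :
    \sum_(a < m) c a *: vlift (Y a) p =
    row_mx 0 (\sum_(a < m) c a *: Y a (tbase p)) :> tangent p.
  apply/rowP => l; rewrite summxE; case: (split_ordP l) => e ->.
    rewrite row_mxEl mxE big1 // => a _.
    by rewrite mxE row_mxEl mxE mulr0.
  rewrite row_mxEr summxE.
  by apply: eq_bigr => a _; rewrite !mxE (unsplitK (inr e)).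
have gspan (c : 'I_m -> R) (p : tbundle Q) (w : tangent p) :
    g (tbase p) (\sum_(a < m) c a *: Y a (tbase p)) (lsubmx w) =
    \sum_(a < m) c a * vlift1 (f a) p w.
  rewrite (scalar_comb _ _ _ (g_scalarl _ _)).
  by apply: eq_bigr => a _; rewrite vlift1E gY.
have flatE (c : 'I_m -> R) (p : tbundle Q) (w : tangent p) :
    complete_lift g p (\sum_(a < m) c a *: vlift (Y a) p) w =
    \sum_(a < m) c a * vlift1 (f a) p w.
  by rewrite vspan complete_lift_vertical // gspan.
have flat_span p : flat (complete_lift g) p @` vlift_dist Y p = vlift1_span f p.
  apply/seteqP; split=> [_ [_ [c ->] <-]|_ [c ->]].
    by exists c; apply/funext => w; exact: flatE.
  exists (\sum_(a < m) c a *: vlift (Y a) p); first by exists c.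
  by apply/funext => w; exact: flatE.
have resE p (w : tangent p) :
    residual p w = - \sum_(a < m) u a p * vlift1 (f a) p w.
  rewrite /residual -GE /iprod /Gamma /closed_loop vspan.
  rewrite omega_ofDl addrC addKr omega_vertical //.
  by rewrite gspan.
have invP := makes_invariantP sG Y_smooth phi_smooth phi_submersive u_control.
split=> [tau ctau itau||//].
- have tauT := (makes_invariantP sG Y_smooth phi_smooth phi_submersive ctau).1
    itau.
  split=> [/invP uT p Mp|H]; last by apply/invP => p /H[].
  split; last exact: uT.
  apply/funext => w; rewrite resE; congr (- _); apply/eqP.
  rewrite -subr_eq0 -sumrB; apply/eqP.
  under eq_bigr do rewrite -mulrBl.
  rewrite -gspan.
  (* Both closed-loop fields are tangent at [p] and differ by this input. *)
  have vd : \sum_(a < m) (u a p - tau a p) *: vlift (Y a) p = 0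
      :> 'rV[R]_(n + n).
    apply: (transversal_diff_eq0 (M_transversal p Mp) (uT p Mp) (tauT p Mp)).
      by exists (fun a => u a p - tau a p).
    rewrite /closed_loop opprD addrACA subrr add0r -sumrB.
    by apply: eq_bigr => a _; rewrite scalerBl.
  have -> : \sum_(a < m) (u a p - tau a p) *: Y a (tbase p) = 0.
    by move: vd; rewrite vspan => /(congr1 rsubmx); rewrite row_mxKr linear0.
  exact: (scalar0 (g_scalarl _ _)).
- split=> [/invP uT p Mp|H]; last by apply/invP => p /H[].
  split; last exact: uT.
  rewrite flat_span; exists (fun a => - u a p); apply/funext => w.
  by rewrite resE -sumrN; apply: eq_bigr => a _; rewrite mulNr.
Qed.
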